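(* Let $\mu$ be a probability measure on $\mathbb{R}^d$ with finite second moment that is absolutely continuous with respect to Lebesgue measure, and let $\tilde\mu$ be its image by a self-adjoint unitary transformation $\sigma$ on $\mathbb{R}^d$ (i.e. $\sigma=\sigma^*$ and $\sigma^2=I$). Then there exists a convex function $\varphi:\mathbb{R}^d\to\mathbb{R}$ such that $$\nabla\varphi_\#\mu=\tilde\mu\quad\text{and}\quad \varphi^*(\sigma(x))=\varphi(x)\ \text{ for } x\in\mathbb{R}^d,$$ where $\varphi^*$ is the Legendre transform of $\varphi$.
   Context: The Legendre transform is $\varphi^*(y)=\sup_{x\in\mathbb{R}^d}\{\langle x,y\rangle-\varphi(x)\}$. For a measurable map $T$, $T_\#\mu$ denotes the push-forward (image) of $\mu$ by $T$; thus $\tilde\mu=\sigma_\#\mu$. $I$ is the identity on $\mathbb{R}^d$.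
   Formalization: The convex function φ is allowed the value +∞ (never −∞), since a finite φ on all of R^d need not exist: for d=1, μ=Exp(1), σ=−I, a finite convex φ has φ' bounded below on (0,∞), whereas σ_#μ is unbounded below. *)

(* Defs.v *)
From HB Require Import structures.
From mathcomp Require Import all_boot all_order all_algebra.
From mathcomp Require Import all_classical all_reals all_analysis.

Set Implicit Arguments.
Unset Strict Implicit.
Unset Printing Implicit Defensive.

Import Order.TTheory GRing.Theory Num.Theory.
Import numFieldNormedType.Exports.

Local Open Scope classical_set_scope.
Local Open Scope ring_scope.

(* R^d is 'rV[R]_d.  The library puts the sup norm on it: the topology, the
   Borel sets and (Frechet) differentiability are the Euclidean ones, but the
   Euclidean inner product has to be supplied. *)

Section borel_rV.
Context (R : realType) (d : nat).

HB.instance Definition _ := @isMeasurable.Build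
  (sigma_display (@open 'rV[R]_d)) 'rV[R]_d <<s @open 'rV[R]_d >>
  (@sigma_algebra0 _ setT _) (@sigma_algebraC _ _)
  (@sigma_algebra_bigcup _ setT _).

End borel_rV.

Definition dotv (R : realType) (d : nat) (x y : 'rV[R]_d) : R :=
  \sum_(i < d) x 0 i * y 0 i.

(* The d-fold product of the Lebesgue measure of R; on R^0, a single point, it
   is the Dirac mass.  It is a measure on the Borel sets, but is only given as
   a set function, which is all that absolute continuity requires. *)
Fixpoint lebesgue_rV (R : realType) (d : nat) : set 'rV[R]_d -> \bar R :=
  match d with
  | 0 => fun A => \d_(0 : 'rV[R]_0) A
  | n.+1 => pushforward (lebesgue_measure \x @lebesgue_rV R n)%E
              (fun p : R * 'rV[R]_n => row_mx p.1%:M p.2 : 'rV[R]_n.+1)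
  end.

Definition finite_second_moment (R : realType) (d : nat)
    (mu : {measure set 'rV[R]_d -> \bar R}) : Prop :=
  (\int[mu]_x (dotv x x)%:E < +oo)%E.

Definition selfadjoint (R : realType) (d : nat) (s : 'rV[R]_d -> 'rV[R]_d) :
    Prop :=
  forall x y, dotv (s x) y = dotv x (s y).

(* Convex functions in the sense of convex analysis, with values in
   ]-oo, +oo]. *)
Definition convex_ext (R : realType) (d : nat) (phi : 'rV[R]_d -> \bar R) :
    Prop :=
  (forall x, phi x != -oo%E) /\
  (forall (x y : 'rV[R]_d) (t : R), 0 <= t <= 1 ->
    (phi (t *: x + (1 - t) *: y)%R <= t%:E * phi x + (1 - t)%:E * phi y)%E).

Definition legendre (R : realType) (d : nat) (phi : 'rV[R]_d -> \bar R)
    (y : 'rV[R]_d) : \bar R :=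
  ereal_sup [set ((dotv x y)%:E - phi x)%E | x in [set: 'rV[R]_d]].

Definition is_gradient (R : realType) (d : nat) (phi : 'rV[R]_d -> \bar R)
    (x v : 'rV[R]_d) : Prop :=
  [/\ \forall y \near x, phi y \is a fin_num,
      differentiable (fine \o phi) x
    & forall h, 'd (fine \o phi) x h = dotv v h].

(* (grad phi)_# mu = nu.  The gradient of a convex function is only defined
   almost everywhere; its image measure is that of any Borel map T which
   coincides with it mu-almost everywhere. *)
Definition gradient_pushforward (R : realType) (d : nat)
    (phi : 'rV[R]_d -> \bar R) (mu : {measure set 'rV[R]_d -> \bar R})
    (nu : set 'rV[R]_d -> \bar R) : Prop :=
  exists T : 'rV[R]_d -> 'rV[R]_d,
    [/\ measurable_fun setT T,
        {ae mu, forall x, is_gradient phi x (T x)}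
      & forall A, measurable A -> pushforward mu T A = nu A].

(* Main.v *)
Require Import Defs.
From HB Require Import structures.
From mathcomp Require Import all_boot all_order all_algebra.
From mathcomp Require Import all_classical all_reals all_analysis.
From mathcomp Require Import measurable_realfun ring lra.

(** The convex function is found as the minimiser of a dual transport problem in
    which the symmetry of [sigma] has been built in.

    Since [sigma] is self-adjoint, [c x y = dotv x (sigma y)] is symmetric, and
    the equation [phi^*(sigma x) = phi x] says that [phi] equals its conjugate
    [sup_y (c x y - phi y)] for the pairing [c].  Among the functions with
    [c x y <= phi x + phi y] for all [x] and [y], take one whose [mu]-integral is
    minimal.  As [sigma] is an isometry, [|c x y| <= q x + q y] with
    [q x = dotv x x / 2], so that [phi + q] is nonnegative, and the second moment
    makes the infimum finite.  The minimum is attained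
    ([exists_argmin_integral]): almost minimisers which also nearly maximise a
    strictly concave bounded functional converge almost everywhere.  Zorn's lemma
    then gives below the minimiser a function which is equal to its conjugate
    everywhere ([exists_self_conjugate]); its integral is still minimal, and as a
    supremum of affine functions it is convex and lower semicontinuous.

    A convex function is differentiable at Lebesgue-almost every point where it is
    finite.  On a line parallel to an axis, only countably many points are kinks
    ([countable_kinks]); by Fubini, almost no point is a kink for any of the axes
    ([ae_smooth_along]); at the other points all partial derivatives exist, and
    convexity makes [phi] differentiable there ([has_partial_is_gradient]).

    For the image measure, let [V] be open and [U] its preimage by [sigma].  If the
    gradient of [phi] at [x] lies in [V], then for some [eps > 0] the inequality
    [c x y <= phi x + phi y] holds with a margin [eps] for all [y] outside [U]
    ([gradient_gap]).  Let [E] be the set of the points [x] with this property for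
    a given [eps].  Then [phi] can be raised by [eps / 2] on [U] and lowered by
    [eps / 2] on [E] without breaking the constraint, and minimality gives
    [mu E <= mu U] ([slack_measure_le]).  Letting [eps] decrease to 0, the image of
    [mu] by the gradient is at most its image by [sigma] on every open set.  Two
    probabilities in this relation are equal ([eq_measure_of_le_open]). *)

Set Implicit Arguments.
Unset Strict Implicit.
Unset Printing Implicit Defensive.

Import Order.TTheory GRing.Theory Num.Theory.
Import numFieldNormedType.Exports.

Local Open Scope classical_set_scope.
Local Open Scope ring_scope.

(** * Almost everywhere convergence from summable increments *)

(** With [t = 2 ^ n * |w n.+1 x - w n x|], the inequality [t <= 1 + t ^ 2] turns
    second moments of order [4 ^- n] into first moments of order [2 ^- n].  The
    increments are therefore absolutely summable almost everywhere. *)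
Lemma ae_cvg_of_summable_L2_increments d (T : measurableType d) (R : realType)
    (mu : probability T R) (w : nat -> T -> R) (C : R) :
  (forall n, measurable_fun setT (w n)) ->
  (forall n, \int[mu]_x (((w n.+1 x - w n x) ^+ 2)%:E) <= (C / 4 ^+ n)%:E)%E ->
  {ae mu, forall x, cvgn (w ^~ x)}.
Proof.
move=> mw wC.
pose D n x : R := w n.+1 x - w n x.
have mD n : measurable_fun setT (D n) by apply: measurable_funB.
have mN n : measurable_fun setT (fun x => `|D n x|%:E).
  by apply/measurable_EFinP; apply: measurableT_comp.
have mS n : measurable_fun setT (fun x => ((D n x) ^+ 2)%:E).
  by apply/measurable_EFinP; apply: measurable_funX.
have leD n : (\int[mu]_x (`|D n x|%:E) <=
     (((C + 1) * 2) / (2 ^ n.+1)%:R)%:E)%E.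
  have p2 : (0 : R) < 2 ^+ n by rewrite exprn_gt0.
  apply: (@le_trans _ _
    (\int[mu]_x (((2 ^+ n)^-1)%:E + (2 ^+ n)%:E * ((D n x) ^+ 2)%:E))%E).
    apply: ge0_le_integral => //.
    - by apply: emeasurable_funD => //; exact: measurable_funeM.
    - move=> x _; rewrite -EFinM -EFinD lee_fin.
      set t := 2 ^+ n * `|D n x|.
      have -> : `|D n x| = (2 ^+ n)^-1 * t by rewrite /t mulKf// gt_eqF.
      have -> : 2 ^+ n * D n x ^+ 2 = (2 ^+ n)^-1 * t ^+ 2.
        by rewrite /t -real_normK ?num_real// exprMn; field; rewrite gt_eqF.
      rewrite -{2}[(2 ^+ n)^-1]mulr1 -mulrDr ler_pM2l ?invr_gt0//.
      nra.
  rewrite ge0_integralD//=; last 2 first.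
  - by move=> x _; rewrite -EFinM lee_fin mulr_ge0 ?sqr_ge0// ltW.
  - exact: measurable_funeM.
  rewrite ge0_integralZl//; last first.
  - by move=> x _; rewrite lee_fin sqr_ge0.
  rewrite integral_cst//=. rewrite probability_setT mule1.
  have := wC n; rewrite -(@lee_pmul2l _ (2 ^+ n)%:E) ?lte_fin// -EFinM.
  rewrite -(@leeD2lE _ ((2 ^+ n)^-1)%:E)// => /le_trans; apply.
  rewrite -EFinD lee_fin natrX exprS.
  have -> : (4 : R) = 2 ^+ 2 by ring.
  rewrite -exprM mulnC exprM.
  have : (C / (2 ^+ n) ^+ 2 * 2 ^+ n) = C / 2 ^+ n by field; rewrite gt_eqF.
  rewrite mulrC => ->.
  by rewrite le_eqVlt; apply/orP; left; apply/eqP; field; rewrite gt_eqF.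
have C0 : 0 <= C.
  have := wC 0%N; rewrite expr0 divr1 -lee_fin; apply: le_trans.
  by apply: integral_ge0 => x _; rewrite lee_fin sqr_ge0.
have sum_fin : (\int[mu]_x (\sum_(n <oo) `|D n x|%:E) < +oo)%E.
  rewrite integral_nneseries//.
  apply: (le_lt_trans (lee_nneseries (v := fun n =>
    (((C + 1) * 2) / (2 ^ n.+1)%:R)%:E) _ _)).
  - by move=> n _ _; apply: integral_ge0.
  - by move=> n _; exact: leD.
  have h : 0 <= (C + 1) * 2 by rewrite mulr_ge0// addr_ge0.
  by apply: (le_lt_trans (epsilon_trick0 xpredT h)); rewrite ltry.
have sge0 x : (0 <= \sum_(n <oo) `|D n x|%:E)%E by apply: nneseries_ge0.
have : mu.-integrable setT (fun x => \sum_(n <oo) `|D n x|%:E)%E.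
  apply/integrableP; split.
    by apply: ge0_emeasurable_sum.
  by under eq_integral do rewrite gee0_abs//.
move=> /(integrable_ae measurableT); apply: filterS => x /(_ I) finx.
have cD : cvgn (series (fun n => D n x)).
  apply: normed_cvg; apply: nnseries_is_cvg => [i|]; first exact: normr_ge0.
  by have := finx; rewrite ge0_fin_numE.
have -> : w ^~ x = fun n => w 0%N x + series (fun n => D n x) n.
  by apply/funext => n; rewrite seriesEnat/= telescope_sumr// addrC subrK.
by apply: is_cvgD => //; exact: is_cvg_cst.
Qed.

(** * Minimising an integral over a class closed under midpoints and upper limits *)

Definition mide (R : realType) (a b : \bar R) : \bar R := ((2^-1)%:E * (a + b))%E.

Lemma mide_ge0 (R : realType) (a b : \bar R) :
  (0 <= a -> 0 <= b -> 0 <= mide a b)%E.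
Proof. by move=> a0 b0; rewrite mule_ge0 ?adde_ge0// lee_fin invr_ge0. Qed.

Lemma contract_ge0 (R : realType) (a : \bar R) : (0 <= a)%E -> 0 <= contract a.
Proof. by move=> a0; rewrite -contract0 le_contract. Qed.

(** A quantitative form of the strict concavity of [contract] on the nonnegative
    extended reals.  For real [a] and [b], with [u = 1 / (1 + a)] and
    [v = 1 / (1 + b)], the difference between the value at the midpoint and the
    mean of the values is [(u - v) ^ 2 / (2 * (u + v))], and [u + v <= 2]. *)
Lemma contract_mide (R : realType) (a b : \bar R) : (0 <= a)%E -> (0 <= b)%E ->
  (contract a + contract b) / 2 + (contract b - contract a) ^+ 2 / 4
    <= contract (mide a b).
Proof.
have key (r : R) : 0 <= r ->
    (r / (1 + r) + 1) / 2 + (1 - r / (1 + r)) ^+ 2 / 4 <= 1.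
  move=> r0.
  have [u0 u1] : 0 <= r / (1 + r) /\ r / (1 + r) <= 1.
    by split; [rewrite divr_ge0// addr_ge0|rewrite ler_pdivrMr; lra].
  by set u := r / (1 + r) in u0 u1 *; nra.
case: a => [a| |]//; case: b => [b| |]//; rewrite ?lee_fin /mide => a0 b0 /=.
- have ab0 : 0 <= 2^-1 * (a + b) by rewrite mulr_ge0 ?addr_ge0// invr_ge0.
  rewrite !ger0_norm//.
  set A := 1 + a; set B := 1 + b.
  have A0 : 1 <= A by rewrite lerDl.
  have B0 : 1 <= B by rewrite lerDl.
  have -> : a = A - 1 by rewrite /A addrC addKr.
  have -> : b = B - 1 by rewrite /B addrC addKr.
  set v := A^-1; set w := B^-1.
  have hA : A * v = 1 by rewrite mulfV//; apply/eqP; lra.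
  have hB : B * w = 1 by rewrite mulfV//; apply/eqP; lra.
  have v0 : 0 < v by rewrite invr_gt0; lra.
  have w0 : 0 < w by rewrite invr_gt0; lra.
  have v1 : v <= 1 by rewrite invf_le1; lra.
  have w1 : w <= 1 by rewrite invf_le1; lra.
  have -> : (A - 1) * v = 1 - v by rewrite mulrBl hA mul1r.
  have -> : (B - 1) * w = 1 - w by rewrite mulrBl hB mul1r.
  have -> : 2^-1 * (A - 1 + (B - 1)) / (1 + 2^-1 * (A - 1 + (B - 1))) =
     1 - 2 * v * w / (v + w).
    have An : A != 0 by apply/eqP; lra.
    have Bn : B != 0 by apply/eqP; lra.
    rewrite /v /w; field.
    rewrite An Bn; apply/and3P; split => //; apply/eqP; lra.
  have vw : 0 < v + w by lra.
  rewrite -subr_ge0.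
  have -> : 1 - 2 * v * w / (v + w) - ((1 - v + (1 - w)) / 2 +
      (1 - w - (1 - v)) ^+ 2 / 4) =
      (v - w) ^+ 2 * (2 - (v + w)) / (4 * (v + w)).
    by field; rewrite gt_eqF.
  have h1 : 0 <= (v - w) ^+ 2 * (2 - (v + w)).
    by apply: mulr_ge0; [exact: sqr_ge0|lra].
  by apply: divr_ge0 => //; lra.
- rewrite addey// gt0_muley ?lte_fin ?invr_gt0//= ger0_norm//.
  by have := key a a0; lra.
- rewrite addye// gt0_muley ?lte_fin ?invr_gt0//= ger0_norm//.
  by have := key b b0; lra.
- by rewrite gt0_muley ?lte_fin ?invr_gt0//= subrr expr0n/= mul0r addr0; lra.
Qed.

Lemma measurable_contract d (T : measurableType d) (R : realType)
    (g : T -> \bar R) :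
  measurable_fun setT g -> measurable_fun setT (fun x => contract (g x)).
Proof.
move=> mg.
rewrite (_ : (fun x => _) = fun x => if g x \is a fin_num
    then contract (fine (g x))%:E else if (g x <= 0)%E then -1 else 1); last first.
  by apply/funext => x; case: (g x) => [r||] //=; rewrite ?leye_eq ?leNye.
apply: measurable_fun_ifT.
- by apply: (measurable_fun_bool true); exact: emeasurable_fin_num.
- apply: (@measurableT_comp _ _ _ _ _ _ (fun r : R => contract r%:E)).
    apply: nondecreasing_measurable => // r s rs.
    by rewrite le_contract lee_fin.
  exact: measurableT_comp.
- apply: measurable_fun_ifT => //.
  exact: measurable_fun_lee.
Qed.


Lemma limn_einf_ge0 (R : realType) (u : (\bar R)^nat) :
  (forall n, 0 <= u n)%E -> (0 <= limn_einf u)%E.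
Proof.
move=> u0; rewrite limn_einf_lim; apply: lime_ge; first exact: is_cvg_einfs.
by apply: nearW => n; apply: le_ereal_inf_tmp => _ [m _ <-].
Qed.

Lemma measurable_fun_limn_einf d (T : measurableType d) (R : realType)
    (f : (T -> \bar R)^nat) :
  (forall n, measurable_fun setT (f n)) ->
  measurable_fun setT (fun x => limn_einf (f ^~ x)).
Proof.
move=> mf; rewrite /limn_einf; apply: measurableT_comp => //.
apply: (@measurable_fun_limn_esup _ _ _ _ (fun n x => - f n x)%E) => n.
exact: measurableT_comp.
Qed.

(** The distance on the extended reals is the one for which [contract] is an
    isometry, so convergence after contraction is convergence. *)
Lemma cvgn_contract (R : realType) (u : (\bar R)^nat) :
  cvgn (fun n => contract (u n)) -> limn_einf u = limn_esup u.
Proof.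
move=> /cvg_ex[/= l ul].
have l1 : `|l| <= 1.
  apply: (cvgr_to_le (cvg_norm ul)).
  by apply: nearW => n; exact: contract_le1.
suff h : u @ \oo --> expand l.
  by have [-> ->] := cvg_limn_einf_sup h.
apply/(@cvg_ballP R (\bar R)) => e e0; near=> n.
rewrite /ball /= /ereal_ball expandK ?inE//.
near: n.
by move/cvgrPdist_lt : ul; apply.
Unshelve. all: by end_near. Qed.

Lemma integral_mide d (T : measurableType d) (R : realType)
    (mu : {measure set T -> \bar R}) (f g : T -> \bar R) :
  (forall x, 0 <= f x)%E -> (forall x, 0 <= g x)%E ->
  measurable_fun setT f -> measurable_fun setT g ->
  (\int[mu]_x mide (f x) (g x) = mide (\int[mu]_x f x) (\int[mu]_x g x))%E.
Proof.
move=> f0 g0 mf mg; rewrite /mide ge0_integralZl_EFin ?invr_ge0//.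
- by rewrite ge0_integralD.
- by move=> x _; rewrite adde_ge0.
- exact: emeasurable_funD.
Qed.

(** In the absence of compactness the minimising sequence [u] has to be chosen
    well: among the elements of [K] whose integral is nearly minimal, [u n] nearly
    maximises the integral of [contract].  The midpoint of [u n] and [u n.+1] is a
    competitor for that maximum, and by [contract_mide] this makes the increments
    of the contracted sequence small in L2.  Hence [u] converges almost
    everywhere, and Fatou's lemma applies to its upper limit.

    The closure condition asks for upper limits because an inequality
    [C <= g x + g y] between values at all points survives upper limits. *)
Lemma exists_argmin_integral d (T : measurableType d) (R : realType)
    (mu : probability T R) (K : set (T -> \bar R)) :
  K !=set0 ->
  (forall g, K g -> forall x, 0 <= g x)%E ->
  (forall g, K g -> measurable_fun setT g) ->
  (forall g h, K g -> K h -> K (fun x => mide (g x) (h x))) ->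
  (forall u : (T -> \bar R)^nat, (forall n, K (u n)) ->
    K (fun x => limn_esup (u ^~ x))) ->
  exists2 g, K g & (forall h, K h -> \int[mu]_x g x <= \int[mu]_x h x)%E.
Proof.
move=> [g0 Kg0] K0 Km Kmid Klim.
set I := fun g : T -> \bar R => (\int[mu]_x g x)%E.
set I0 := ereal_inf [set I g | g in K].
have I0le g : K g -> (I0 <= I g)%E.
  by move=> Kg; apply: ereal_inf_lbound; exists g.
have I0ge : (0 <= I0)%E.
  by apply: le_ereal_inf_tmp => _ [g Kg <-]; apply: integral_ge0 => x _; exact: K0.
have [I0y|I0y] := eqVneq I0 +oo%E.
  by exists g0 => // h Kh; rewrite -/(I h) (le_trans _ (I0le _ Kh))// I0y leey.
have I0fin : I0 \is a fin_num by rewrite ge0_fin_numE// lt_neqAle I0y leey.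
pose V g : R := fine (\int[mu]_x (contract (g x))%:E).
have mc g : K g -> measurable_fun setT (fun x => (contract (g x))%:E).
  by move=> Kg; apply/measurable_EFinP; apply: measurable_contract; exact: Km.
have c0 g : K g -> forall x, (0 <= (contract (g x))%:E)%E.
  by move=> Kg x; rewrite lee_fin contract_ge0// K0.
have Vle g : K g -> (\int[mu]_x (contract (g x))%:E <= 1)%E.
  move=> Kg; apply: (@le_trans _ _ (\int[mu]_x (cst 1%E x))%E).
    apply: ge0_le_integral => //.
    - by move=> x _; exact: c0.
    - exact: mc.
    - by move=> x _; rewrite lee_fin (le_trans (ler_norm _))// contract_le1.
  by rewrite integral_cst//= mul1e probability_setT.
have VE g : K g -> (\int[mu]_x (contract (g x))%:E)%E = (V g)%:E.
  move=> Kg; rewrite fineK// ge0_fin_numE; last first.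
    by apply: integral_ge0 => x _; exact: c0.
  by rewrite (le_lt_trans (Vle g Kg))// ltry.
have V01 g : K g -> 0 <= V g <= 1.
  move=> Kg; rewrite -!lee_fin -VE// Vle// andbT.
  by apply: integral_ge0 => x _; exact: c0.
pose near_opt c := [set g | K g /\ (I g <= I0 + c%:E)%E].
have near_ex c : 0 < c -> exists g, near_opt c g.
  move=> cp; have [_ [g Kg <-] /ltW gc] := lb_ereal_inf_adherent cp I0fin.
  by exists g.
pose J c := sup [set V g | g in near_opt c].
have supJ c : 0 < c -> has_sup [set V g | g in near_opt c].
  move=> cp; split; first by have [g cg] := near_ex c cp; exists (V g), g.
  by exists 1 => _ [g [Kg _] <-]; have /andP[] := V01 g Kg.
have VJ c g : 0 < c -> near_opt c g -> V g <= J c.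
  by move=> cp cg; apply: sup_upper_bound; [exact: supJ|exists g].
pose Jstar := inf [set J c | c in [set c | 0 < c]].
have infJ : has_inf [set J c | c in [set c | 0 < c]].
  split; first by exists (J 1), 1 => //; exact: ltr01.
  exists 0 => _ [c /= cp <-]; have [g cg] := near_ex c cp.
  by apply: le_trans (VJ _ _ cp cg); have /andP[] := V01 g cg.1.
have H1 (e : R) : 0 < e ->
    exists c, 0 < c /\ forall g, near_opt c g -> V g <= Jstar + e.
  move=> e0; have [_ [c /= cp <-] /ltW Jc] := inf_adherent e0 infJ.
  by exists c; split => // g cg; exact: le_trans (VJ _ _ cp cg) Jc.
have H2 (c e : R) : 0 < c -> 0 < e ->
    exists g, near_opt c g /\ Jstar - e <= V g.
  move=> cp e0; have [_ [g cg <-] /ltW Jc] := sup_adherent e0 (supJ c cp).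
  exists g; split => //; apply: le_trans Jc; rewrite lerD2r.
  by apply: ge_inf; [exact: infJ.2|exists c].
pose q n : R := (4 ^+ n)^-1.
have q0 n : 0 < q n by rewrite invr_gt0 exprn_gt0.
have qS n : q n.+1 <= q n.
  by rewrite lef_pV2 ?posrE ?exprn_gt0// exprS ler_peMl ?exprn_ge0 ?ler1n.
have [c cP] := choice (fun n => H1 (q n) (q0 n)).
(* The function u n enters the midpoints of rank n and n.-1, so its integral
   is kept below both thresholds; at rank 0 they coincide. *)
pose e n : R := Num.min (Num.min (c n) (c n.-1)) (q n).
have e0 n : 0 < e n by rewrite !lt_min q0 (cP n).1 (cP n.-1).1.
have [u uP] := choice (fun n => H2 (e n) (q n) (e0 n) (q0 n)).
have Ku n : K (u n) by have [[]] := uP n.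
have incr n : (\int[mu]_x (((contract (u n.+1 x) - contract (u n x)) ^+ 2)%:E)
    <= (16 / 4 ^+ n)%:E)%E.
  pose m x := mide (u n x) (u n.+1 x).
  have Km' : K m by exact: Kmid.
  have Vm : V m <= Jstar + q n.
    apply: (cP n).2; split => //.
    have [[_ In] _] := uP n; have [[_ In1] _] := uP n.+1.
    have -> : I m = mide (I (u n)) (I (u n.+1)).
      by apply: integral_mide; by [exact: K0|exact: Km].
    have -> : (I0 + (c n)%:E = mide (I0 + (c n)%:E) (I0 + (c n)%:E))%E.
      rewrite /mide -(fineK I0fin) -!EFinD -EFinM; congr (_%:E).
      by field.
    rewrite lee_pmul2l ?lte_fin ?invr_gt0//; apply: leeD.
      by apply: (le_trans In); rewrite leeD2l// lee_fin !ge_min lexx.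
    by apply: (le_trans In1); rewrite leeD2l// lee_fin !ge_min lexx orbT.
  have mint : (\int[mu]_x ((4^-1)%:E * ((contract (u n.+1 x) - contract (u n x)) ^+ 2)%:E
      + mide (contract (u n x))%:E (contract (u n.+1 x))%:E)
     <= \int[mu]_x (contract (m x))%:E)%E.
    apply: ge0_le_integral => //.
    - move=> x _; rewrite adde_ge0 ?mide_ge0 ?c0//.
      by rewrite -EFinM lee_fin mulr_ge0 ?sqr_ge0.
    - apply: emeasurable_funD.
        apply: measurable_funeM; apply/measurable_EFinP.
        by apply: measurable_funX; apply: measurable_funB;
          apply: measurable_contract; exact: Km.
      by apply: measurable_funeM; apply: emeasurable_funD; exact: mc.
    - exact: mc.
    - move=> x _; rewrite /mide -!(EFinM, EFinD) lee_fin.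
      have := contract_mide (K0 _ (Ku n) x) (K0 _ (Ku n.+1) x).
      by rewrite /m; lra.
  have mS : measurable_fun setT
      (fun x => ((contract (u n.+1 x) - contract (u n x)) ^+ 2)%:E).
    apply/measurable_EFinP; apply: measurable_funX; apply: measurable_funB;
    by apply: measurable_contract; exact: Km.
  move: mint; rewrite ge0_integralD//=; last 4 first.
  - by move=> x _; rewrite -EFinM lee_fin mulr_ge0 ?sqr_ge0.
  - exact: measurable_funeM.
  - by move=> x _; rewrite mide_ge0// c0.
  - by apply: measurable_funeM; apply: emeasurable_funD; exact: mc.
  rewrite ge0_integralZl//=; last first.
    by move=> x _; rewrite lee_fin sqr_ge0.
  rewrite integral_mide; [|exact: c0|exact: c0|exact: mc|exact: mc].
  rewrite !VE//.
  have [_ Vn] := uP n; have [_ Vn1] := uP n.+1.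
  have : (0 <= \int[mu]_x ((contract (u n.+1 x) - contract (u n x)) ^+ 2)%:E)%E.
    by apply: integral_ge0 => x _; rewrite lee_fin sqr_ge0.
  case: (\int[mu]_x _)%E => [r||]//.
    rewrite /mide -!(EFinM, EFinD) !lee_fin => r0 hr.
    have := qS n; have := q0 n.+1; rewrite -/(q n); lra.
  by rewrite gt0_muley ?lte_fin ?invr_gt0// addye// leye_eq.
have ae_cvg : {ae mu, forall x, limn_einf (u ^~ x) = limn_esup (u ^~ x)}.
  have := ae_cvg_of_summable_L2_increments
    (fun n => measurable_contract (Km _ (Ku n))) incr.
  by apply: filterS => x; exact: cvgn_contract.
exists (fun x => limn_esup (u ^~ x)); first exact: Klim.
move=> h Kh; apply: le_trans (I0le h Kh).
rewrite (@ge0_ae_eq_integral _ _ _ mu setT _ (fun x => limn_einf (u ^~ x)))//.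
- apply: le_trans; first apply: fatou => //.
  + by move=> n; exact: Km.
  + by move=> n x _; exact: K0.
  suff hI : (fun n => I (u n)) @ \oo --> I0.
    by have [-> _] := cvg_limn_einf_sup hI.
  have sq : \forall n \near \oo, (I0 <= I (u n) <= I0 + (q n)%:E)%E.
    apply: nearW => n; rewrite I0le//=; have [[_ In] _] := uP n.
    by apply: (le_trans In); rewrite leeD2l// lee_fin !ge_min lexx orbT.
  apply: (squeeze_cvge sq).
  + exact: cvg_cst.
  + rewrite -[X in _ --> X]adde0; apply: cvgeD => //; first by rewrite fin_num_adde_defl.
      exact: cvg_cst.
    apply/cvg_EFin; first by apply: nearW.
    rewrite (_ : _ \o _ = geometric 1 4^-1); last first.
      by apply/funext => n /=; rewrite /q exprVn mul1r.
    by apply: cvg_geometric; rewrite ger0_norm// invf_lt1 ?ltr1n.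
- exact: Km (Klim _ Ku).
- by apply: measurable_fun_limn_einf => n; exact: Km.
- by move=> x _; exact: K0 (Klim _ Ku) x.
- by move=> x _; apply: limn_einf_ge0 => n; exact: K0.
- by apply: filterS ae_cvg => x ->.
Qed.

(** * Self-conjugate functions for a symmetric pairing *)

Section conjugate.
Context (X : Type) (R : realType) (c : X -> X -> R).
Implicit Types f g : X -> \bar R.

(** The constraint of the dual transport problem for the cost [c], with the same
    potential for both marginals. *)
Definition admissible f := forall x y, ((c x y)%:E <= f x + f y)%E.

Definition conjugate f x : \bar R :=
  ereal_sup [set ((c x y)%:E - f y)%E | y in [set: X]].

Lemma admissible_gtNy f x : admissible f -> (-oo < f x)%E.
Proof. by move=> /(_ x x); case: (f x) => // r _; rewrite ltNyr. Qed.

Lemma conjugate_ge f x y : ((c x y)%:E - f y <= conjugate f x)%E.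
Proof. by apply: ereal_sup_ubound; exists y. Qed.

Lemma conjugate_le f : admissible f -> forall x, (conjugate f x <= f x)%E.
Proof.
move=> fa x; apply: ge_ereal_sup => _ [y _ <-].
have := fa x y; have := admissible_gtNy x fa; have := admissible_gtNy y fa.
case: (f y) => [r||]//.
- by move=> _ _; rewrite leeBlDr.
- by move=> _ _ _; rewrite leNye.
Qed.

Lemma admissible_half f x : admissible f -> ((c x x / 2)%:E <= f x)%E.
Proof.
move=> /(_ x x); case: (f x) => [r| |//]; last by move=> _; rewrite leey.
by rewrite -EFinD !lee_fin => h; lra.
Qed.

Hypothesis csym : forall x y, c x y = c y x.

(** Zorn's lemma.  The pointwise infimum of a chain is admissible: to compare [c x y]
    with the infimum at [x] plus the infimum at [y], take one function of the
    chain for each and use the smaller of the two at both points. *)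
Lemma minimal_admissible f0 : admissible f0 ->
  exists f, [/\ admissible f, forall x, (f x <= f0 x)%E &
    forall g, admissible g -> (forall x, g x <= f x)%E -> g = f].
Proof.
move=> f0a.
pose T := {f : X -> \bar R | admissible f /\ forall x, (f x <= f0 x)%E}.
pose below (f g : T) := `[< forall x, (sval g x <= sval f x)%E >].
pose t0 : T := exist _ f0 (conj f0a (fun x => lexx (f0 x))).
have [|||A totA|t tmin] := @Zorn T below.
- by move=> t; apply/asboolP => x.
- move=> r s t /asboolP rs /asboolP st; apply/asboolP => x.
  exact: le_trans (st x) (rs x).
- move=> [r rP] [s sP] /asboolP/= rs /asboolP/= sr; apply: eq_exist.
  by apply/funext => x; apply/eqP; rewrite eq_le rs sr.
- pose B := A `|` [set t0].
  have totB : total_on B below.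
    move=> s t [As|->] [At|->]; first exact: totA.
    + by right; apply/asboolP => x; exact: (svalP s).2.
    + by left; apply/asboolP => x; exact: (svalP t).2.
    + by left; apply/asboolP => x.
  pose m x := ereal_inf [set sval t x | t in B].
  have ma : admissible m.
    move=> x y.
    have mge z : ((c z z / 2)%:E <= m z)%E.
      apply: le_ereal_inf_tmp => _ [t _ <-].
      by apply: admissible_half; exact: (svalP t).1.
    have mNy z : (m z != -oo)%E.
      by rewrite -ltNye (lt_le_trans _ (mge z))// ltNyr.
    have [mxy|mxy] := eqVneq (m x) +oo%E.
      by rewrite mxy addye// leey.
    have [myy|myy] := eqVneq (m y) +oo%E.
      by rewrite myy addey// leey.
    have mxf : m x \is a fin_num by rewrite fin_numE mNy mxy.
    have myf : m y \is a fin_num by rewrite fin_numE mNy myy.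
    apply/lee_addgt0Pr => e e0.
    have e20 : 0 < e / 2 by rewrite divr_gt0.
    have [_ [s Bs <-] /ltW sx] := lb_ereal_inf_adherent e20 mxf.
    have [_ [t Bt <-] /ltW ty] := lb_ereal_inf_adherent e20 myf.
    have [r [Br rx ry]] : exists r, [/\ B r, (sval r x <= m x + (e / 2)%:E)%E
        & (sval r y <= m y + (e / 2)%:E)%E].
      have [/asboolP st|/asboolP ts] := totB _ _ Bs Bt.
        by exists t; split => //; exact: le_trans sx.
      by exists s; split => //; exact: le_trans ty.
    apply: (le_trans ((svalP r).1 x y)); apply: (le_trans (leeD rx ry)).
    by rewrite addeACA -EFinD -splitr.
  have mle x : (m x <= f0 x)%E.
    by apply: ereal_inf_lbound; exists t0 => //; right.
  exists (exist _ m (conj ma mle)) => s As; apply/asboolP => x /=.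
  by apply: ereal_inf_lbound; exists s => //; left.
- exists (sval t); split; [exact: (svalP t).1|exact: (svalP t).2|].
  move=> g ga gt.
  have gle x : (g x <= f0 x)%E by apply: (le_trans (gt x)); exact: (svalP t).2.
  have tg : below t (exist _ g (conj ga gle)) by apply/asboolP.
  by have /(congr1 sval) := tmin _ tg.
Qed.

(** If a minimal admissible [f] exceeded its conjugate at [a], its value at the
    single point [a] could be lowered to the larger of the conjugate and
    [c a a / 2]; the second bound is the constraint for the pair [(a, a)]. *)
Lemma exists_self_conjugate f0 : admissible f0 ->
  exists f, [/\ admissible f, forall x, (f x <= f0 x)%E &
    forall x, conjugate f x = f x].
Proof.
move=> /minimal_admissible[f [fa ff0 fmin]]; exists f; split => // a.
(* The new value at a, which the constraint bounds from below by both terms. *)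
pose v := maxe (conjugate f a) (c a a / 2)%:E.
pose g x := if pselect (x = a) then v else f x.
have vhalf : ((c a a / 2)%:E <= v)%E by rewrite le_max lexx orbT.
have vf y : ((c a y)%:E <= v + f y)%E.
  have : ((c a y)%:E - f y <= v)%E by rewrite le_max conjugate_ge.
  have := admissible_gtNy y fa; case: (f y) => [r||]//.
    by move=> _; rewrite leeBlDr.
  by rewrite addey ?leey// -ltNye (lt_le_trans _ vhalf)// ltNyr.
have ga : admissible g.
  move=> x y; rewrite /g; case: pselect => xa; case: pselect => ya //=; rewrite ?xa ?ya//.
  - by apply: le_trans (leeD vhalf vhalf); rewrite -EFinD -splitr.
  - by rewrite csym addeC.
have gf x : (g x <= f x)%E.
  rewrite /g; case: pselect => xa //=.
  by rewrite xa ge_max conjugate_le// admissible_half.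
have := congr1 (@^~ a) (fmin g ga gf); rewrite /g; case: pselect => // aa /= fav.
have [le|lt] := leP (c a a / 2)%:E (conjugate f a).
  by rewrite -fav /v max_l.
have := conjugate_ge f a a; rewrite -[in X in (X <= _)%E]fav /v max_r ?(ltW lt)//.
move=> /le_lt_trans/(_ lt).
by rewrite -EFinB lte_fin {1}(splitr (c a a)) addrK ltxx.
Qed.

End conjugate.

(** * Optimal potentials *)

(** A lower bound on sums passes to upper limits taken separately, which fails for
    lower limits. *)
Lemma lee_limn_esupD (R : realType) (u v : (\bar R)^nat) (C : \bar R) :
  (forall n, 0 <= u n)%E -> (forall n, 0 <= v n)%E ->
  (forall n, C <= u n + v n)%E -> (C <= limn_esup u + limn_esup v)%E.
Proof.
move=> u0 v0 Cuv.
have ge n (w : (\bar R)^nat) : (w n <= esups w n)%E.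
  by apply: ereal_sup_ubound; exists n => /=.
have esup0 (w : (\bar R)^nat) : (forall n, 0 <= w n)%E -> (0 <= limn_esup w)%E.
  move=> w0; rewrite limn_esup_lim; apply: lime_ge; first exact: is_cvg_esups.
  by apply: nearW => n; exact: le_trans (ge n w).
have h : (esups u n + esups v n)%E @[n --> \oo] --> (limn_esup u + limn_esup v)%E.
  rewrite !limn_esup_lim; apply: cvgeD; last 2 first.
  - exact: is_cvg_esups.
  - exact: is_cvg_esups.
  by rewrite -!limn_esup_lim ge0_adde_def// inE esup0.
apply: (cvge_to_ge h); apply: nearW => n.
by apply: (le_trans (Cuv n)); apply: leeD.
Qed.

Section optimal_potential.
Context d (T : measurableType d) (R : realType) (mu : probability T R).
Context (c : T -> T -> R) (q : T -> R).
Hypothesis csym : forall x y, c x y = c y x.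
Hypothesis cq : forall x y, `|c x y| <= q x + q y.
Hypothesis mq : measurable_fun setT q.
Hypothesis q_fin : (\int[mu]_x (q x)%:E < +oo)%E.

Lemma q_ge0 x : 0 <= q x.
Proof. by have := le_trans (normr_ge0 _) (cq x x); lra. Qed.

(** These are the functions [phi + q] with [phi] measurable and admissible for [c].
    The shift makes them nonnegative, so that their integrals always exist. *)
Definition potentials := [set g : T -> \bar R | measurable_fun setT g /\
  forall x y, ((c x y + q x + q y)%:E <= g x + g y)%E].

Lemma potential_ge0 g : potentials g -> forall x, (0 <= g x)%E.
Proof.
move=> [_ gP] x; have := gP x x.
have : 0 <= c x x + q x + q x by have := cq x x; rewrite ler_norml; lra.
case: (g x) => [r| |]//= c0.
by rewrite -EFinD !lee_fin; lra.
Qed.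

Lemma potential_q2 : potentials (fun x => (2 * q x)%:E).
Proof.
split; first by apply/measurable_EFinP; apply: measurable_funM.
move=> x y; rewrite -EFinD lee_fin.
by have := cq x y; rewrite ler_norml; lra.
Qed.

Lemma exists_optimal_potential : exists2 g, potentials g &
  (\int[mu]_x g x < +oo)%E /\
  forall h, potentials h -> (\int[mu]_x g x <= \int[mu]_x h x)%E.
Proof.
have [g Kg gmin] : exists2 g, potentials g &
    (forall h, potentials h -> \int[mu]_x g x <= \int[mu]_x h x)%E.
  apply: exists_argmin_integral.
  - by exists (fun x => (2 * q x)%:E); exact: potential_q2.
  - exact: potential_ge0.
  - by move=> g [].
  - move=> g h Kg Kh; have [mg gP] := Kg; have [mh hP] := Kh; split.
      by apply: measurable_funeM; exact: emeasurable_funD.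
    move=> x y; rewrite /mide -ge0_muleDr ?adde_ge0 ?potential_ge0//.
    rewrite addeACA.
    have -> : (c x y + q x + q y)%:E = (2^-1%:E *
        ((c x y + q x + q y)%:E + (c x y + q x + q y)%:E))%E.
      by rewrite -EFinD -EFinM; congr (_%:E); field.
    by rewrite lee_wpmul2l ?lee_fin ?invr_ge0// leeD.
  - move=> u Ku; split.
      by apply: measurable_fun_limn_esup => n; have [] := Ku n.
    move=> x y; apply: lee_limn_esupD => n; try exact: potential_ge0.
    by have [_] := Ku n; apply.
exists g => //; split => //.
apply: (le_lt_trans (gmin _ potential_q2)).
under eq_integral do rewrite EFinM.
rewrite ge0_integralZl//; first by rewrite lte_mul_pinfty// lee_fin.
  by apply/measurable_EFinP.
by move=> x _; rewrite lee_fin q_ge0.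
Qed.

Lemma admissible_shift (g : T -> \bar R) :
  (forall x y, ((c x y + q x + q y)%:E <= g x + g y)%E) <->
  admissible c (fun x => g x - (q x)%:E)%E.
Proof.
split=> gP x y; have := gP x y;
  case: (g x) => [a||]; case: (g y) => [b||] //=; rewrite ?leey ?leeNy_eq//;
  by rewrite -?EFinB -?EFinD !lee_fin; lra.
Qed.

Lemma admissible_potential (phi : T -> \bar R) :
  admissible c phi -> measurable_fun setT phi ->
  potentials (fun x => phi x + (q x)%:E)%E.
Proof.
move=> pa mphi; split.
  by apply: emeasurable_funD => //; exact/measurable_EFinP.
move=> x y; have := pa x y.
have := admissible_gtNy x pa; have := admissible_gtNy y pa.
case: (phi x) => [r||]//; case: (phi y) => [s||]// _ _; rewrite ?leey//.
by rewrite -!EFinD !lee_fin; lra.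
Qed.

(** The function comes from Zorn's lemma, which says nothing on measurability.  The
    latter has to come from the equation [conjugate c phi = phi], hence the
    implication. *)
Lemma exists_self_conjugate_minimizer : exists phi : T -> \bar R,
  [/\ forall x, conjugate c phi x = phi x,
      admissible c phi &
      measurable_fun setT phi ->
      (\int[mu]_x (phi x + (q x)%:E) < +oo)%E /\
      forall h, potentials h ->
        (\int[mu]_x (phi x + (q x)%:E) <= \int[mu]_x h x)%E].
Proof.
have [g Kg [gfin gmin]] := exists_optimal_potential.
have /admissible_shift ga := Kg.2.
have [phi [pa pg pc]] := exists_self_conjugate csym ga.
exists phi; split => // mphi.
have le : (\int[mu]_x (phi x + (q x)%:E) <= \int[mu]_x g x)%E.
  have Kphi := admissible_potential pa mphi.
  apply: ge0_le_integral => //; [|exact: Kphi.1|exact: Kg.1|].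
  - by move=> x _; exact: potential_ge0 Kphi x.
  - by move=> x _; have := pg x; rewrite leeBrDr.
split; first exact: le_lt_trans gfin.
by move=> h Kh; apply: (le_trans le); exact: gmin.
Qed.

End optimal_potential.

(** * First variation of an optimal potential *)

Section variation.
Context d (T : measurableType d) (R : realType) (mu : probability T R).
Context (c : T -> T -> R) (q : T -> R) (phi : T -> \bar R).
Hypothesis csym : forall x y, c x y = c y x.
Hypothesis cq : forall x y, `|c x y| <= q x + q y.
Hypothesis mq : measurable_fun setT q.
Hypothesis phi_adm : admissible c phi.
Hypothesis mphi : measurable_fun setT phi.
Hypothesis phi_fin : (\int[mu]_x (phi x + (q x)%:E) < +oo)%E.
Hypothesis phi_min : forall h, potentials c q h ->
  (\int[mu]_x (phi x + (q x)%:E) <= \int[mu]_x h x)%E.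

(** The first variation.  The pair [phi + eps 1_U], [phi - eps 1_E] satisfies the
    constraint in both orders of the arguments, so the mean
    [phi + eps / 2 (1_U - 1_E)] of its members is admissible, and its integral
    cannot be smaller than that of [phi]. *)
Lemma slack_measure_le (U E : set T) (eps : R) :
  measurable U -> measurable E -> 0 < eps ->
  (forall x y, E x -> ~ U y -> ((c x y + eps)%:E <= phi x + phi y)%E) ->
  (mu E <= mu U)%E.
Proof.
move=> mU mE e0 slack.
pose p x := (phi x + (q x)%:E)%E.
pose b x : R := eps / 2 * (\1_U x - \1_E x).
pose g x := (p x + (b x)%:E)%E.
have Kp : potentials c q p by exact: admissible_potential.
have [mp pC] := Kp.
have mb : measurable_fun setT b.
  by apply: measurable_funM => //; apply: measurable_funB; exact: measurable_indic.
have phiNy x : (-oo < phi x)%E by exact: admissible_gtNy.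
have p0 := potential_ge0 cq Kp.
have Kg : potentials c q g.
  split; first by apply: emeasurable_funD => //; exact/measurable_EFinP.
  move=> x y; rewrite /g.
  have slack' u v : E u -> ~ U v -> ((c u v + q u + q v + eps)%:E <= p u + p v)%E.
    move=> Eu Uv; have := slack u v Eu Uv; have := phiNy u; have := phiNy v; rewrite /p.
    case: (phi u) => [r||]//; case: (phi v) => [s||]// _ _; rewrite ?leey//.
    by rewrite -!EFinD !lee_fin; lra.
  have := pC x y; have := slack' x y; have := slack' y x; rewrite (csym y x).
  have := p0 x; have := p0 y.
  case: (p x) => [r||]//; case: (p y) => [s||]//; rewrite ?leey// => _ _.
  rewrite -!EFinD !lee_fin /b !indicE => yx xy C.
  have notinU w : w \notin U -> ~ U w by rewrite notin_setE.
  move: (fun yE xU => yx (set_mem yE) (notinU _ xU)) => {}yx.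
  move: (fun xE yU => xy (set_mem xE) (notinU _ yU)) => {}xy.
  move: yx xy.
  by case: (x \in U); case: (y \in U); case: (x \in E); case: (y \in E) => /= yx xy;
    try (have := yx isT isT); try (have := xy isT isT); lra.
have g0 := potential_ge0 cq Kg.
have e20 : 0 <= eps / 2 by rewrite divr_ge0// ltW.
have pint : (\int[mu]_x p x)%E \is a fin_num.
  by rewrite ge0_fin_numE// integral_ge0.
have ind (A : set T) : measurable A -> (\int[mu]_x ((eps / 2)%:E * (\1_A x)%:E))%E =
    ((eps / 2)%:E * mu A)%E.
  move=> mA; rewrite ge0_integralZl//=.
  - by rewrite integral_indic// setIT.
  - by apply/measurable_EFinP; exact: measurable_indic.
have m1 (A : set T) : measurable A -> measurable_fun setT (fun x => (eps / 2)%:E * (\1_A x)%:E)%E.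
  move=> mA; apply: measurable_funeM; apply/measurable_EFinP; exact: measurable_indic.
have i0 (A : set T) x : (0 <= (eps / 2)%:E * (\1_A x)%:E :> \bar R)%E.
  by rewrite mule_ge0// lee_fin.
have : (\int[mu]_x (g x + (eps / 2)%:E * (\1_E x)%:E) =
        \int[mu]_x (p x + (eps / 2)%:E * (\1_U x)%:E))%E.
  apply: eq_integral => x _; rewrite /g -addeA; congr (_ + _)%E.
  by rewrite -!EFinM -EFinD /b mulrBr subrK.
rewrite [X in X = _ -> _]ge0_integralD//; [|exact: Kg.1|exact: m1].
rewrite [X in _ = X -> _]ge0_integralD//; [|exact: m1].
rewrite !ind// => eqi.
have := phi_min Kg; rewrite -(@leeD2rE _ ((eps / 2)%:E * mu E)%E); last first.
  by rewrite fin_numM// fin_num_measure.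
rewrite eqi leeD2lE// lee_pmul2l// lte_fin.
by rewrite divr_gt0.
Qed.

End variation.

(** * Elementary lemmas *)

Lemma exists_inv_lt (R : realType) (a : R) : 0 < a -> exists n : nat, n.+1%:R^-1 < a.
Proof.
move=> a0; exists (Num.truncn a^-1).
by rewrite -[ltRHS]invrK ltf_pV2 ?posrE ?invr_gt0//; exact: truncnS_gt.
Qed.

Lemma countable_subset1 T (A : set T) : is_subset1 A -> countable A.
Proof.
move=> A1; have [->|/set0P[x Ax]] := eqVneq A set0; first exact: countable0.
apply: (@sub_countable _ _ _ [set x]); last exact: countable1.
by apply: subset_card_le => y Ay; exact: A1.
Qed.

Lemma common_lower_bound (R : realType) (I : finType) (r : I -> R) : (forall i, 0 < r i) ->
  exists2 s, 0 < s & forall i, s <= r i.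
Proof.
move=> r0; have S0 : 0 <= \sum_i (r i)^-1.
  by apply: sumr_ge0 => i _; rewrite invr_ge0 ltW.
have S1 : 0 < 1 + \sum_i (r i)^-1 by rewrite ltr_pwDl.
(* A minimum would have to treat the empty family apart. *)
exists (1 + \sum_i (r i)^-1)^-1; first by rewrite invr_gt0.
move=> i; rewrite -[leRHS]invrK lef_pV2 ?posrE ?invr_gt0//.
rewrite (bigD1 i)//= addrCA lerDl addr_ge0//.
by apply: sumr_ge0 => j _; rewrite invr_ge0 ltW.
Qed.

(** * Borel maps and Lebesgue measure on row vectors *)

Section borel_rV.
Context (R : realType) (d : nat).
Implicit Types (U : set 'rV[R]_d).

Lemma open_measurable_rV U : open U -> measurable U.
Proof. exact: sub_sigma_algebra. Qed.

Lemma continuous_measurable_rV e (f : 'rV[R]_d -> 'rV[R]_e) :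
  continuous f -> measurable_fun setT f.
Proof.
move=> /continuousP cf; apply: (measurability (@open 'rV[R]_e)) => //.
by move=> _ [V oV <-]; rewrite setTI; apply: open_measurable_rV; exact: cf.
Qed.

Lemma continuous_measurable_real (f : 'rV[R]_d -> R) :
  continuous f -> measurable_fun setT f.
Proof.
move=> /continuousP cf; apply: (measurability _ (RGenOpens.measurableE R)).
move=> _ [_ [a [b ->] <-]]; rewrite setTI; apply: open_measurable_rV.
exact/cf/interval_open.
Qed.

Lemma lsc_measurable_rV (f : 'rV[R]_d -> \bar R) :
  (forall a : R, open [set x | (a%:E < f x)%E]) -> measurable_fun setT f.
Proof.
move=> of_; apply: (measurability _ (ErealGenOInfty.measurableE R)).
move=> _ [_ [a ->] <-]; rewrite setTI preimage_itvoy.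
by apply: open_measurable_rV; exact: of_.
Qed.

Lemma measurable_coord_rV (i : 'I_d) :
  measurable_fun setT (fun x : 'rV[R]_d => x 0 i).
Proof. by apply: continuous_measurable_real => x; exact: coord_continuous. Qed.

(** An open set is the union of the countably many cubes with rational centre and
    side [2 / n.+1] that it contains. *)
Lemma measurable_fun_rV d' (T : measurableType d') (f : T -> 'rV[R]_d) :
  (forall i, measurable_fun setT (fun x => f x 0 i)) -> measurable_fun setT f.
Proof.
move=> mf; apply: (measurability (@open 'rV[R]_d)) => //.
move=> _ [U oU <-]; rewrite setTI.
pose r (p : 'rV[rat]_d) : 'rV[R]_d := map_mx ratr p.
pose B (p : 'rV[rat]_d * nat) : set 'rV[R]_d :=
  [set y | forall i, `|r p.1 0 i - y 0 i| < p.2.+1%:R^-1].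
pose P : set ('rV[rat]_d * nat) := [set p | B p `<=` U].
have -> : f @^-1` U = \bigcup_p (if pselect (P p) then f @^-1` B p else set0).
  apply/seteqP; split => [x Ufx|x [p _]]; last first.
    by case: pselect => // Pp; exact: Pp.
  have [e /= e0 eU] : nbhs_ball (f x) U by apply/nbhs_ballP; exact: open_nbhs_nbhs.
  have [n ne] : exists n : nat, n.+1%:R^-1 < e / 2.
    exists (Num.truncn (e / 2)^-1).
    rewrite -[ltRHS]invrK ltf_pV2 ?posrE ?invr_gt0 ?divr_gt0//.
    exact: truncnS_gt.
  have n0 : (0 : R) < n.+1%:R^-1 by rewrite invr_gt0.
  have ex_q i : exists q : rat, `|ratr q - f x 0 i| < n.+1%:R^-1.
    have lt : f x 0 i - n.+1%:R^-1 < f x 0 i + n.+1%:R^-1.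
      by rewrite ltrD2l; apply: (lt_trans _ n0); rewrite oppr_lt0.
    have [q qP] := rat_in_itvoo lt.
    by exists q; move: qP; rewrite in_itv/= ltr_norml => /andP[q1 q2];
      by apply/andP; split; [rewrite ltrBrDr addrC|rewrite ltrBlDl].
  have [q qP] := choice ex_q.
  exists (\row_i q i, n) => //.
  case: pselect => [_ i|].
    by rewrite /r !mxE; exact: qP.
  case=> y By; apply: eU; split => // i j; rewrite (ord1 i).
  have := By j; have := qP j; rewrite /r /= !mxE /ball /= => h1 h2.
  rewrite -(subrK (ratr (q j)) (f x 0 j)) -addrA.
  apply: (le_lt_trans (ler_normD _ _)).
  rewrite distrC [ltRHS]splitr; apply: ltrD; exact: lt_trans ne.
apply: countable_bigcupT_measurable; first exact: countableP.
move=> p; case: pselect => Pp //=.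
have -> : f @^-1` B p =
    \bigcap_(i in [set: 'I_d]) [set x | `|r p.1 0 i - f x 0 i| < p.2.+1%:R^-1].
  by apply/seteqP; split => [x Bx i _|x Bx i]; [exact: Bx|exact: (Bx i I)].
apply: fin_bigcap_measurable; first exact: finite_finset.
move=> i _; rewrite -[X in measurable X]setTI.
have m : measurable_fun setT (fun x => `|r p.1 0 i - f x 0 i|).
  by apply: measurableT_comp => //; apply: measurable_funB.
rewrite [X in measurable (_ `&` X)](_ : _ =
  (fun x => `|r p.1 0 i - f x 0 i|) @^-1` `]-oo, p.2.+1%:R^-1[).
  by apply: m.
by apply/seteqP; split => x /=; rewrite in_itv.
Qed.

End borel_rV.

(** Gives a bare set function the structure which Fubini's theorem asks for. *)
Lemma sigma_finite_measure_of d (T : measurableType d) (R : realType)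
    (m : set T -> \bar R) :
  m set0 = 0%E -> (forall A, 0 <= m A)%E -> semi_sigma_additive m ->
  sigma_finite setT m ->
  exists L : {sigma_finite_measure set T -> \bar R}, L = m :> (set T -> \bar R).
Proof.
move=> m0 mge0 madd mfin.
pose mM := isMeasure.Build _ _ _ m m0 mge0 madd.
pose M1 : {measure set T -> \bar R} := HB.pack m mM.
pose sM := Measure_isSigmaFinite.Build _ _ _ M1 mfin.
pose M2 : {sigma_finite_measure set T -> \bar R} := HB.pack m mM sM.
by exists M2.
Qed.

Lemma sigma_finite_product d1 d2 (T1 : measurableType d1)
    (T2 : measurableType d2) (R : realType)
    (m1 : {sigma_finite_measure set T1 -> \bar R})
    (m2 : {sigma_finite_measure set T2 -> \bar R}) :
  sigma_finite setT (m1 \x m2)%E.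
Proof.
have [F FT Ffin] := sigma_finiteT m1.
have [G GT Gfin] := sigma_finiteT m2.
pose c n := odflt (0%N, 0%N) (@unpickle (nat * nat)%type n).
exists (fun n => F (c n).1 `*` G (c n).2).
  apply/esym/seteqP; split => // -[x y] _.
  have [i _ Fx] : (\bigcup_i F i) x by rewrite -FT.
  have [j _ Gy] : (\bigcup_i G i) y by rewrite -GT.
  by exists (pickle (i, j)) => //; rewrite /c pickleK.
move=> n; have [mF Fo] := Ffin (c n).1; have [mG Go] := Gfin (c n).2.
split; first exact: measurableX.
by rewrite product_measure1E// lte_mul_pinfty// ge0_fin_numE.
Qed.

Section lebesgue_rV_measure.
Context (R : realType).

Definition glue_rV n (p : R * 'rV[R]_n) : 'rV[R]_n.+1 := row_mx p.1%:M p.2.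

(** The inverse of [glue_rV]; its measurability carries sigma-finiteness from the
    product to the space of row vectors. *)
Definition split_rV n (x : 'rV[R]_n.+1) : R * 'rV[R]_n :=
  (x 0 0, \row_i x 0 (lift 0 i)).

Lemma glue_rV0 n (p : R * 'rV[R]_n) : glue_rV p 0 0 = p.1.
Proof.
rewrite /glue_rV mxE; case: splitP => j /= j0; last by [].
by rewrite ord1 mxE eqxx mulr1n.
Qed.

Lemma glue_rV_lift n (p : R * 'rV[R]_n) i : glue_rV p 0 (lift 0 i) = p.2 0 i.
Proof.
rewrite /glue_rV mxE; case: splitP => j /= j0; first by case: j j0 => -[].
by congr (p.2 0 _); apply: val_inj => /=; case: j0.
Qed.

Lemma glue_rVK n : cancel (@glue_rV n) (@split_rV n).
Proof.
move=> [s v]; rewrite /split_rV glue_rV0; congr (_, _).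
by apply/rowP => i; rewrite mxE glue_rV_lift.
Qed.

Lemma measurable_glue_rV n :
  measurable_fun setT (@glue_rV n : measurableTypeR R * 'rV[R]_n -> 'rV[R]_n.+1).
Proof.
apply: measurable_fun_rV => i; have [j ->|->] := unliftP 0 i.
  under eq_fun do rewrite glue_rV_lift.
  exact: (measurableT_comp (measurable_coord_rV j) measurable_snd).
under eq_fun do rewrite glue_rV0.
exact: measurable_fst.
Qed.

Lemma measurable_split_rV n :
  measurable_fun setT (@split_rV n : 'rV[R]_n.+1 -> measurableTypeR R * 'rV[R]_n).
Proof.
apply: measurable_fun_pair; first exact: measurable_coord_rV.
apply: measurable_fun_rV => i.
by under eq_fun do rewrite mxE; exact: measurable_coord_rV.
Qed.

Lemma lebesgue_rV_sigma_finite n : exists L : {sigma_finite_measure set 'rV[R]_n -> \bar R},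
  L = @lebesgue_rV R n :> (set 'rV[R]_n -> \bar R).
Proof.
elim: n => [|n [L LE]]; first by exists (\d_(0 : 'rV[R]_0)).
pose M := pushforward (lebesgue_measure \x L)%E
  (@glue_rV n : measurableTypeR R * 'rV[R]_n -> 'rV[R]_n.+1).
have ME : M = @lebesgue_rV R n.+1 by rewrite /M /= LE.
have mg := @measurable_glue_rV n.
have M0 : M set0 = 0%E by rewrite /M; exact: measure0.
have Mge0 A : (0 <= M A)%E by exact: measure_ge0.
have Madd : semi_sigma_additive M by exact: measure_semi_sigma_additive.
have Msf : sigma_finite setT M.
  have [F FT Ffin] := sigma_finite_product lebesgue_measure L.
  exists (fun k => @split_rV n @^-1` F k).
    by rewrite -preimage_bigcup -FT preimage_setT.
  move=> k; have [mF Fk] := Ffin k; split.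
    by rewrite -[X in measurable X]setTI; exact: measurable_split_rV.
  suff -> : M (@split_rV n @^-1` F k) = (lebesgue_measure \x L)%E (F k) by [].
  rewrite /M /pushforward; congr (_ _).
  by apply/seteqP; split => p /=; rewrite glue_rVK.
have [L1 L1E] := sigma_finite_measure_of M0 Mge0 Madd Msf.
by exists L1; rewrite L1E.
Qed.

Lemma product_lebesgue_swap n (L : {sigma_finite_measure set 'rV[R]_n -> \bar R})
    (A : set (measurableTypeR R * 'rV[R]_n)) : measurable A ->
  (lebesgue_measure \x L)%E A = (lebesgue_measure \x^ L)%E A.
Proof.
apply: product_measure_unique => B C mB mC.
exact: product_measure2E.
Qed.

Lemma glue_rVDl n (t : R) (v : 'rV[R]_n) :
  glue_rV (t, v) = glue_rV (0, v) + t *: delta_mx 0 0.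
Proof.
apply/rowP => i; rewrite [RHS]mxE [X in _ = _ + X]mxE [X in _ * X]mxE.
have [j ->|->] := unliftP 0 i.
  by rewrite !glue_rV_lift /= mulr0 addr0.
by rewrite !glue_rV0 /= ?eqxx mulr1 add0r.
Qed.

Lemma glue_rVDr n (t s : R) (v : 'rV[R]_n) (j : 'I_n) :
  glue_rV (s, v + t *: delta_mx 0 j) =
  glue_rV (s, v) + t *: delta_mx 0 (lift 0 j).
Proof.
apply/rowP => i; rewrite [RHS]mxE [X in _ = _ + X]mxE [X in _ * X]mxE.
have [k ->|->] := unliftP 0 i.
  by rewrite !glue_rV_lift !mxE /= (inj_eq lift_inj).
by rewrite !glue_rV0 /= mulr0 addr0.
Qed.

(** By induction on the dimension.  If [i] is the first axis, the sections along it
    are countable, and the order of integration is exchanged; otherwise the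
    sections with fixed first coordinate satisfy the induction hypothesis. *)
Lemma lebesgue_rV_countable_lines n (i : 'I_n) (B : set 'rV[R]_n) :
  measurable B ->
  (forall x, countable [set t | B (x + t *: delta_mx 0 i)]) ->
  @lebesgue_rV R n B = 0%E.
Proof.
elim: n i B => [[]//|n IHn] i B mB Bi.
have [L LE] := lebesgue_rV_sigma_finite n.
pose A : set (measurableTypeR R * 'rV[R]_n) := @glue_rV n @^-1` B.
have mA : measurable A.
  by rewrite -[X in measurable X]setTI; exact: measurable_glue_rV.
have -> : @lebesgue_rV R n.+1 B = (lebesgue_measure \x L)%E A by rewrite LE.
have [j ij|i0] := unliftP 0 i.
  apply: integral0_eq => s _ /=; rewrite LE; apply: (IHn j).
    exact: measurable_xsection.
  move=> v; rewrite ij in Bi; apply: sub_countable (Bi (glue_rV (s, v))).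
  apply: subset_card_le => t /=.
  by rewrite /xsection /= inE /A /= glue_rVDr.
rewrite product_lebesgue_swap//; apply: integral0_eq => v _ /=.
apply: countable_lebesgue_measure0.
rewrite i0 in Bi; apply: sub_countable (Bi (glue_rV (0, v))).
apply: subset_card_le => t /=.
by rewrite /ysection /= inE /A /= (glue_rVDl t v).
Qed.

End lebesgue_rV_measure.

(** * Kinks of a convex function along a line *)

Section kinks.
Context (R : realType) (d : nat) (f : 'rV[R]_d -> \bar R).
Hypothesis fconv : convex_ext f.
Implicit Types (x e : 'rV[R]_d) (t h r q : R).

(** Second differences of [f] divided by the step [1 / n.+1].  For a convex [f] these
    quotients are nonnegative and decrease with the step, so where [f] is finite
    this says that the two one-sided derivatives along [e] are finite and agree.  Quantifying over countably many
    steps makes it a Borel condition on [x]. *)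
Definition smooth_along e x := forall k : nat, exists n : nat,
  (f (x + n.+1%:R^-1 *: e) + f (x - n.+1%:R^-1 *: e) <
   f x + f x + (k.+1%:R^-1 * n.+1%:R^-1)%:E)%E.

Lemma convex_chord x e (v q h r : R) : f x = v%:E -> 0 < h -> 0 <= r <= h ->
  (f (x + h *: e) <= (v + q * h)%:E)%E -> (f (x + r *: e) <= (v + q * r)%:E)%E.
Proof.
move=> fx h0 /andP[r0 rh] fh.
have [_ /(_ (x + h *: e) x (r / h)) cv] := fconv.
have -> : x + r *: e = (r / h) *: (x + h *: e) + (1 - r / h) *: x.
  by rewrite scalerDr scalerA divfK ?gt_eqF// scalerBl scale1r [RHS]addrC addrA subrK.
have rh1 : r / h <= 1 by rewrite ler_pdivrMr// mul1r.
have rh0 : 0 <= r / h by rewrite divr_ge0// ltW.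
apply: le_trans; first by apply: cv; rewrite rh0 rh1.
rewrite fx -EFinM.
apply: (@le_trans _ _ ((r / h)%:E * (v + q * h)%:E + ((1 - r / h) * v)%:E)%E).
  by rewrite leeD2r// lee_wpmul2l// lee_fin.
rewrite -EFinM -EFinD lee_fin le_eqVlt; apply/orP; left; apply/eqP.
by field; rewrite gt_eqF.
Qed.

(** At a kink inside the domain, any rational slope strictly between the one-sided
    derivatives will do.  Otherwise every rational would be the slope of a line
    through [(x, v)] which meets the epigraph again, on the right (set [A]) or on
    the left (set [B]).  Passing from [B] to [A] in small steps gives two close
    slopes in [A] and [B], which bound the second difference quotient. *)
Lemma kink_slope e x v : f x = v%:E ->
  (exists2 a, 0 < a & (f (x + a *: e) < +oo)%E) ->
  (exists2 b, 0 < b & (f (x - b *: e) < +oo)%E) ->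
  ~ smooth_along e x ->
  exists q : rat, forall h, h != 0 -> ((v + ratr q * h)%:E < f (x + h *: e))%E.
Proof.
move=> fx [a a0 fa] [b b0 fb] /existsNP[k kP].
apply: contrapT => noq; apply: kP.
pose A (q : R) := exists2 h, 0 < h & (f (x + h *: e) <= (v + q * h)%:E)%E.
pose B (q : R) := exists2 h, 0 < h & (f (x - h *: e) <= (v - q * h)%:E)%E.
have AB (q : rat) : A (ratr q) \/ B (ratr q).
  have /existsNP[h /not_implyP[h0 /negP]] : ~ forall h, h != 0 ->
      ((v + ratr q * h)%:E < f (x + h *: e))%E.
    by move=> hq; apply: noq; exists q.
  rewrite -leNgt => fh; have [hn|hp|h00] := ltgtP h 0.
  - right; exists (- h); first by rewrite oppr_gt0.
    by rewrite scaleNr opprK mulrN opprK.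
  - by left; exists h.
  - by rewrite h00 eqxx in h0.
have Amono q q' : q <= q' -> A q -> A q'.
  move=> qq [h h0 fh]; exists h => //; apply: (le_trans fh).
  by rewrite lee_fin lerD2l ler_pM2r.
have Bmono q q' : q' <= q -> B q -> B q'.
  move=> qq [h h0 fh]; exists h => //; apply: (le_trans fh).
  by rewrite lee_fin lerD2l lerN2 ler_pM2r.
have fin y : (f y < +oo)%E -> exists w : R, f y = w%:E.
  by have [/(_ y)] := fconv; case: (f y) => // w _ _; exists w.
have [fa' faE] := fin _ fa; have [fb' fbE] := fin _ fb.
have Aa : A ((fa' - v) / a).
  by exists a => //; rewrite faE lee_fin divfK ?gt_eqF// addrC subrK.
have Bb : B ((v - fb') / b).
  by exists b => //; rewrite fbE lee_fin divfK ?gt_eqF// opprB addrC subrK.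
have e0 : (0 : R) < k.+1%:R^-1 by rewrite invr_gt0.
have [dl dlP] := rat_in_itvoo e0.
have {dlP}[dl0 dl1] : 0 < ratr dl :> R /\ ratr dl < k.+1%:R^-1 :> R.
  by move: dlP; rewrite in_itv /= => /andP[].
have [p0 p0P] : exists p : rat, ratr p < (v - fb') / b.
  have lt : (v - fb') / b - 1 < (v - fb') / b by rewrite ltrBlDr ltrDl.
  have [p pP] := rat_in_itvoo lt.
  by exists p; move: pP; rewrite in_itv/= => /andP[].
(* The first p n in A is either p 0, which is also in B, or has its predecessor
   in B. *)
pose p n : rat := p0 + dl *+ n.
have Bp0 : B (ratr (p 0%N)) by apply: Bmono Bb; rewrite /p mulr0n addr0 ltW.
have [N AN] : exists N, A (ratr (p N)).
  exists (Num.truncn (((fa' - v) / a - ratr p0) / ratr dl)).+1.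
  apply: Amono Aa; rewrite /p rmorphD rmorphMn /= -lerBlDl -mulr_natl.
  by rewrite -ler_pdivrMr// ltW// truncnS_gt.
have exA : exists n, `[< A (ratr (p n)) >] by exists N; apply/asboolP.
have [q1 [q2 [Aq Bq qq]]] : exists q1 q2 : R, [/\ A q1, B q2 & q1 - q2 < k.+1%:R^-1].
  case: (ex_minnP exA) => -[|n] /asboolP An nmin.
    by exists (ratr (p 0%N)), (ratr (p 0%N)); split => //; rewrite subrr.
  exists (ratr (p n.+1)), (ratr (p n)); split => //.
    have [/asboolP Apn|//] := AB (p n).
    by have := nmin _ Apn; rewrite ltnn.
  by rewrite -rmorphB /p mulrSr addrA (addrC _ dl) addrK.
have [h h0 fh] := Aq; have [h' h'0 fh'] := Bq.
have [n nP] : exists n : nat, n.+1%:R^-1 < Num.min h h'.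
  by apply: exists_inv_lt; rewrite lt_min h0.
exists n; set r := n.+1%:R^-1 in nP *.
have r0 : 0 < r by rewrite invr_gt0.
move: nP; rewrite lt_min => /andP[rh rh'].
have f1 : (f (x + r *: e) <= (v + q1 * r)%:E)%E.
  by apply: (convex_chord fx h0) => //; rewrite (ltW r0) ltW.
have f2 : (f (x - r *: e) <= (v - q2 * r)%:E)%E.
  rewrite -scalerN -mulNr; apply: (convex_chord fx h'0).
    by rewrite (ltW r0) ltW.
  by rewrite scalerN mulNr.
apply: (le_lt_trans (leeD f1 f2)).
rewrite fx -!EFinD lte_fin.
have : (q1 - q2) * r < k.+1%:R^-1 * r by rewrite ltr_pM2r.
by move: (k.+1%:R^-1 * r) => z; lra.
Qed.

(** A kink is either an end of the interval on which [f] is finite, or for some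
    rational [q] the only point of the line where [f] minus the linear function of
    slope [q] is minimal.  Each of these sets has at most one element. *)
Lemma countable_kinks e x : countable
  [set t | (f (x + t *: e) < +oo)%E /\ ~ smooth_along e (x + t *: e)].
Proof.
pose u t := f (x + t *: e).
have uD t h : f (x + t *: e + h *: e) = u (t + h) by rewrite /u scalerDl addrA.
have uB t h : f (x + t *: e - h *: e) = u (t - h) by rewrite /u scalerBl addrA.
pose Er := [set t | (u t < +oo)%E /\ forall h, 0 < h -> u (t + h) = +oo%E].
pose El := [set t | (u t < +oo)%E /\ forall h, 0 < h -> u (t - h) = +oo%E].
pose Q (q : rat) := [set t | forall h, h != 0 ->
  (u t + (ratr q * h)%:E < u (t + h)%R)%E].
pose F (i : rat + bool) :=
  match i with inl q => Q q | inr b => if b then Er else El end.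
apply: (@sub_countable _ _ _ (\bigcup_i F i)).
  apply: subset_card_le => t [/= ft nt].
  have [v fx] : exists v, f (x + t *: e) = v%:E.
    by have [/(_ (x + t *: e))] := fconv; move: ft; case: (f _) => // w _ _; exists w.
  have [Ert|nEr] := pselect (Er t); first by exists (inr true).
  have [Elt|nEl] := pselect (El t); first by exists (inr false).
  have [//|//|q qP] := kink_slope fx _ _ nt.
  - apply: contrapT => nr; apply: nEr; split => // h h0.
    apply/eqP/negPn/negP => hy; apply: nr; exists h => //.
    by rewrite uD ltey.
  - apply: contrapT => nr; apply: nEl; split => // h h0.
    apply/eqP/negPn/negP => hy; apply: nr; exists h => //.
    by rewrite uB ltey.
  exists (inl q) => // h h0.
  by rewrite -uD; have := qP h h0; rewrite /u fx EFinD.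
apply: bigcup_countable => // -[q|[]] _; apply: countable_subset1; last 2 first.
- move=> s t [us hs] [ut ht].
  have [st|st|//] := ltgtP s t.
    by move: ut; rewrite -(subrK s t) addrC hs ?subr_gt0// ltxx.
  by move: us; rewrite -(subrK t s) addrC ht ?subr_gt0// ltxx.
- move=> s t [us hs] [ut ht].
  have [st|st|//] := ltgtP s t.
    by move: us; rewrite -(subKr t s) ht ?subr_gt0// ltxx.
  by move: ut; rewrite -(subKr s t) hs ?subr_gt0// ltxx.
- move=> s t Qs Qt.
  apply/eqP/negPn/negP => st.
  have := Qs (t - s); rewrite subr_eq0 eq_sym => /(_ st).
  have := Qt (s - t); rewrite subr_eq0 => /(_ st).
  rewrite (addrC t (s - t)) subrK (addrC s (t - s)) subrK.
  have [/(_ (x + s *: e)) us _] := fconv.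
  have [/(_ (x + t *: e)) ut _] := fconv.
  move: us ut; rewrite -/(u s) -/(u t).
  case: (u s) => [us||]//; case: (u t) => [ut||]// _ _.
  by rewrite -!EFinD !lte_fin; lra.
Qed.

End kinks.

(** * From one-sided expansions along the axes to differentiability *)

Section gradient.
Context (R : realType) (d : nat) (f : 'rV[R]_d -> \bar R).
Hypothesis fconv : convex_ext f.
Implicit Types (x e w : 'rV[R]_d) (t h r q v : R).

(** A supporting inequality, which with the second condition makes [p] the infimum
    of the slopes of the chords starting at [x] in the direction [e], and a two-sided
    upper expansion, which is all that convexity needs to produce a derivative. *)
Definition has_partial x e v p :=
  (forall h, 0 < h -> ((v + p * h)%:E <= f (x + h *: e))%E) /\
  (forall eps, 0 < eps -> exists2 r, 0 < r &
    forall s, `|s| <= r -> (f (x + s *: e) <= (v + p * s + eps * `|s|)%:E)%E).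

Lemma convex_midpoint x (h : 'rV[R]_d) v : f x = v%:E ->
  ((v + v)%:E <= f (x + h) + f (x - h))%E.
Proof.
move=> fx; have [fN /(_ (x + h) (x - h) 2^-1) cv] := fconv.
have := fN (x + h); have := fN (x - h).
have : (f x <= 2^-1%:E * f (x + h)%R + (1 - 2^-1)%:E * f (x - h)%R)%E.
  have {1}-> : x = 2^-1 *: (x + h) + (1 - 2^-1) *: (x - h).
    have -> : (1 - 2^-1 : R) = 2^-1 by field.
    rewrite -scalerDr addrACA subrr addr0 scalerDr -scalerDl.
    by rewrite (_ : 2^-1 + 2^-1 = 1 :> R) ?scale1r//; field.
  by apply: cv; rewrite invr_ge0 ler0n invf_le1// ler1n.
have -> : (1 - 2^-1 : R) = 2^-1 by field.
rewrite fx; case: (f (x + h)) => [a||]//; case: (f (x - h)) => [b||]// + _ _;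
  rewrite ?addey ?addye ?leey//.
by rewrite -!EFinM -!EFinD !lee_fin; lra.
Qed.

(** The derivative is the infimum of the slopes of the chords that start at [x] in
    the direction [e]; smoothness brings the slopes of the chords in the opposite
    direction arbitrarily close to it. *)
Lemma smooth_has_partial x e v : f x = v%:E -> smooth_along f e x ->
  exists p, has_partial x e v p.
Proof.
move=> fx sm.
pose A (q : R) := exists2 h, 0 < h & (f (x + h *: e) <= (v + q * h)%:E)%E.
pose B (q : R) := exists2 h, 0 < h & (f (x - h *: e) <= (v - q * h)%:E)%E.
have fin y : (f y < +oo)%E -> exists w : R, f y = w%:E.
  by have [/(_ y)] := fconv; case: (f y) => // w _ _; exists w.
have BA p q : B p -> A q -> p <= q.
  move=> [h' h'0 fh'] [h h0 fh].
  pose r := Num.min h h'.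
  have r0 : 0 < r by rewrite lt_min h0.
  have rh : r <= h by rewrite ge_min lexx.
  have rh' : r <= h' by rewrite ge_min lexx orbT.
  have f1 : (f (x + r *: e) <= (v + q * r)%:E)%E.
    by apply: (convex_chord fconv fx h0) => //; rewrite (ltW r0).
  have f2 : (f (x - r *: e) <= (v - p * r)%:E)%E.
    rewrite -scalerN -mulNr; apply: (convex_chord fconv fx h'0).
      by rewrite (ltW r0).
    by rewrite scalerN mulNr.
  have := le_trans (convex_midpoint (r *: e) fx) (leeD f1 f2).
  rewrite -EFinD lee_fin => le2; rewrite -(ler_pM2r r0).
  by move: le2; move: (q * r) (p * r) => a b; lra.
have AB eps : 0 < eps -> exists p q, [/\ B p, A q & q - p < eps].
  move=> e0; have [k ke] := exists_inv_lt e0; have [n] := sm k.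
  set r := n.+1%:R^-1; have r0 : 0 < r by rewrite invr_gt0.
  rewrite fx; have := fin (x + r *: e); have := fin (x - r *: e).
  have [fN _] := fconv; have := fN (x + r *: e); have := fN (x - r *: e).
  case fp : (f (x + r *: e)) => [a||]//; case fm : (f (x - r *: e)) => [b||]// _ _ _ _.
  rewrite -!EFinD lte_fin => ab.
  exists ((v - b) / r), ((a - v) / r); split.
  - by exists r => //; rewrite fm lee_fin divfK ?gt_eqF// opprB addrC subrK.
  - by exists r => //; rewrite fp lee_fin divfK ?gt_eqF// addrC subrK.
  - apply: lt_trans ke; rewrite -mulrBl ltr_pdivrMr//.
    by move: ab; move: (k.+1%:R^-1 * r) => z; lra.
have [p0 [q0 [Bp0 Aq0 _]]] := AB 1 ltr01.
have hA : has_inf [set q | A q].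
  by split; [exists q0|exists p0 => q Aq; exact: BA].
pose w := inf [set q | A q].
have wA q : A q -> w <= q by move=> Aq; apply: ge_inf => //; exact: hA.2.
have Bw p : B p -> p <= w by move=> Bp; apply: lb_le_inf => [|q Aq]; [exact: hA.1|exact: BA].
exists w; split.
  move=> h h0; rewrite leNgt; apply/negP => fh.
  have [a fa] : exists a, f (x + h *: e) = a%:E.
    by apply: fin; apply: (lt_trans fh); rewrite ltry.
  have : w <= (a - v) / h.
    by apply: wA; exists h => //; rewrite fa lee_fin divfK ?gt_eqF// addrC subrK.
  move: fh; rewrite fa lte_fin ler_pdivlMr//.
  by move: (w * h) => z; lra.
move=> eps e0; have [p [q [Bp Aq pq]]] := AB eps e0.
have [h h0 fh] := Aq; have [h' h'0 fh'] := Bp.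
have qw : q <= w + eps by have := Bw p Bp; lra.
have pw : w - eps <= p by have := wA q Aq; lra.
exists (Num.min h h'); first by rewrite lt_min h0.
move=> s; rewrite le_min => /andP[sh sh'].
have [s0|s0] := leP 0 s.
  rewrite ger0_norm// in sh *.
  apply: (le_trans (convex_chord fconv fx h0 _ fh)); first by rewrite s0.
  by rewrite lee_fin -addrA -mulrDl lerD2l ler_wpM2r.
rewrite ltr0_norm// in sh' *.
have -> : x + s *: e = x + (- s) *: (- e) by rewrite scaleNr scalerN opprK.
apply: (@le_trans _ _ (v + (- p) * (- s))%:E).
  apply: (convex_chord fconv fx h'0); first by rewrite oppr_ge0 (ltW s0).
  by rewrite scalerN mulNr.
rewrite lee_fin.
have : (w - eps) * (- s) <= p * (- s) by rewrite ler_wpM2r// oppr_ge0 ltW.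
by rewrite mulrBl; lra.
Qed.

Lemma convex_mean n (y : 'I_n -> 'rV[R]_d) (b : 'I_n -> R) : (0 < n)%N ->
  (forall i, (f (y i) <= (b i)%:E)%E) ->
  (f (n%:R^-1 *: \sum_i y i) <= (n%:R^-1 * \sum_i b i)%:E)%E.
Proof.
case: n y b => // n y b _; elim: n y b => [|n IHn] y b yb.
  by rewrite !big_ord1 invr1 scale1r mul1r.
have n0 : (n.+1%:R : R) != 0 by rewrite pnatr_eq0.
have n2 : (n.+2%:R : R) != 0 by rewrite pnatr_eq0.
have nn : (n.+2%:R : R) = 1 + n.+1%:R by rewrite -natr1 addrC.
have t01 : 0 <= (n.+2%:R^-1 : R) <= 1.
  by rewrite invr_ge0 ler0n /= invf_le1 ?ltr0n// ler1n.
have t1 : (1 - n.+2%:R^-1 : R) = n.+1%:R / n.+2%:R.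
  by apply: (mulIf n2); rewrite mulrBl mulVf// divfK// mul1r nn addrAC subrr add0r.
have IH := IHn (fun i => y (lift ord0 i)) (fun i => b (lift ord0 i))
  (fun i => yb (lift ord0 i)).
have [_ /(_ (y ord0) (n.+1%:R^-1 *: \sum_i y (lift ord0 i)) _ t01)] := fconv.
rewrite t1 scalerA mulrAC divff// mul1r -scalerDr -big_ord_recl => /le_trans; apply.
rewrite [in leRHS]big_ord_recl mulrDr EFinD; apply: leeD.
  by rewrite EFinM lee_wpmul2l// lee_fin; case/andP: t01.
have -> : n.+2%:R^-1 * (\sum_(i < n.+1) b (lift ord0 i)) =
   (n.+1%:R / n.+2%:R) * (n.+1%:R^-1 * \sum_(i < n.+1) b (lift ord0 i)) :> R.
  by rewrite mulrA (mulrAC _ _ (n.+1%:R^-1)) divff// mul1r.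
by rewrite [leRHS]EFinM lee_wpmul2l// lee_fin divr_ge0.
Qed.

End gradient.

Section frechet.
Context (R : realType) (d : nat).
Implicit Types (x e w h : 'rV[R]_d).

Lemma rV_norm_coord h (i : 'I_d) : `|h 0 i| <= `|h|.
Proof.
rewrite [leRHS]/Num.norm/= mx_normrE.
exact: (le_bigmax _ (fun ij : 'I_1 * 'I_d => `|h ij.1 ij.2|) (0, i)).
Qed.

Lemma dotvC x y : dotv x y = dotv y x :> R.
Proof. by apply: eq_bigr => i _; rewrite mulrC. Qed.

Lemma dotv_is_linear w : linear (dotv w : 'rV[R]_d -> R^o).
Proof.
move=> a x y; rewrite /dotv scaler_sumr -big_split; apply: eq_bigr => i _ /=.
by rewrite !mxE mulrDr mulrCA.
Qed.

HB.instance Definition _ w :=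
  GRing.isLinear.Build R 'rV[R]_d R^o *:%R (dotv w) (dotv_is_linear w).

Lemma dotv_continuous w : continuous (dotv w : 'rV[R]_d -> R).
Proof.
have c i : xpredT i -> continuous (fun h : 'rV[R]_d => w 0 i * h 0 i).
  move=> _ x; apply: (@continuousM _ _ (fun=> w 0 i)).
    exact: cst_continuous.
  exact: coord_continuous.
exact: (continuous_big (@add_continuous R^o) c).
Qed.

Lemma near_norm_le x (r : R) : 0 < r -> \forall y \near x, `|y - x| <= r.
Proof.
move=> r0; apply/nbhs_ballP; exists r => // y.
by rewrite -ball_normE /= distrC => /ltW.
Qed.

Context (f : 'rV[R]_d -> \bar R).
Hypothesis fconv : convex_ext f.
Context (x w : 'rV[R]_d) (v : R).
Hypothesis fx : f x = v%:E.
Hypothesis fw : forall i, has_partial f x (delta_mx 0 i) v (w 0 i).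

(** The point [x + h] is the mean of the [d] points [x + d h_i e_i], where the
    expansions along the axes apply. *)
Lemma frechet_upper (eps : R) : 0 < eps -> exists2 r, 0 < r &
  forall h, `|h| <= r -> (f (x + h) <= (v + dotv w h + eps * `|h|)%:E)%E.
Proof.
have [d0 e0|d0] := eqVneq d 0%N.
  exists 1 => // h _.
  have -> : h = 0 by apply/rowP => i; have := ltn_ord i; rewrite {2}d0.
  by rewrite addr0 fx normr0 mulr0 addr0 lee_fin lerDl /dotv big1// => i _;
    rewrite mxE mulr0.
move=> e0.
have dp : (0 : R) < d%:R by rewrite ltr0n lt0n.
have ed0 : 0 < eps / d%:R by rewrite divr_gt0.
have ex_r (i : 'I_d) : exists r : R, 0 < r /\ forall s : R, `|s| <= r ->
    (f (x + s *: delta_mx 0 i)%R <=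
     (v + w 0%R i * s + eps / d%:R * `|s|)%:E)%E.
  by have [_ /(_ _ ed0)[r r0 rP]] := fw i; exists r.
have [r rP] := choice ex_r.
have [s s0 sr] := common_lower_bound (fun i => (rP i).1).
exists (s / d%:R); first by rewrite divr_gt0.
move=> h hs.
pose y i := x + (d%:R * h 0 i) *: delta_mx 0 i.
pose b i := v + w 0 i * (d%:R * h 0 i) + eps / d%:R * `|d%:R * h 0 i|.
have yb i : (f (y i) <= (b i)%:E)%E.
  apply: (rP i).2; apply: le_trans (sr i).
  rewrite normrM ger0_norm ?ler0n// mulrC -ler_pdivlMr//.
  exact: le_trans (rV_norm_coord h i) hs.
have mean : (f (d%:R^-1 *: \sum_i y i) <= (d%:R^-1 * \sum_i b i)%:E)%E.
  by apply: convex_mean => //; rewrite lt0n.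
have dn0 : d%:R != 0 :> R by rewrite gt_eqF.
have yE : d%:R^-1 *: \sum_i y i = x + h.
  rewrite big_split /= sumr_const card_ord -(scaler_nat d x) scalerDr scalerA mulVf//.
  rewrite scale1r scaler_sumr; congr (_ + _).
  rewrite [RHS]row_sum_delta; apply: eq_bigr => i _.
  by rewrite scalerA mulKf.
rewrite -yE; apply: (le_trans mean); rewrite lee_fin.
rewrite big_split /= big_split /= sumr_const card_ord -[v *+ d]mulr_natl.
rewrite !mulrDr mulKf// lerD//.
  rewrite lerD2l mulr_sumr le_eqVlt; apply/orP; left; apply/eqP.
  by apply: eq_bigr => i _; rewrite mulrCA mulKf.
rewrite mulr_sumr.
have -> : eps * `|h| = \sum_(i < d) (eps / d%:R * `|h|).
  by rewrite sumr_const card_ord -[RHS]mulr_natr mulrAC divfK.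
apply: ler_sum => i _.
rewrite normrM ger0_norm ?ler0n//.
have -> : d%:R^-1 * (eps / d%:R * (d%:R * `|h 0 i|)) = eps / d%:R * `|h 0 i|.
  by field.
by rewrite ler_wpM2l ?(ltW ed0)// rV_norm_coord.
Qed.

(** Convexity bounds [f (x + h)] from below by [2 f x - f (x - h)]. *)
Lemma frechet_lower (eps : R) : 0 < eps -> exists2 r, 0 < r &
  forall h, `|h| <= r -> ((v + dotv w h - eps * `|h|)%:E <= f (x + h))%E.
Proof.
move=> e0; have [r r0 rP] := frechet_upper e0; exists r => // h hr.
have := convex_midpoint fconv h fx; have := rP (- h); rewrite normrN => /(_ hr).
have -> : dotv w (- h) = - dotv w h by exact: linearN.
have [/(_ (x + h)) + _] := fconv; have [/(_ (x - h)) + _] := fconv.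
case: (f (x - h)) => [b||]// _; case: (f (x + h)) => [a||]// _.
- by rewrite -EFinD !lee_fin; lra.
- by move=> _ _; rewrite leey.
Qed.

Lemma has_partial_is_gradient : is_gradient f x w.
Proof.
have fin h r : (forall h, `|h| <= r -> (f (x + h) <= (v + dotv w h + 1 * `|h|)%:E)%E) ->
    `|h| <= r -> f (x + h) \is a fin_num.
  move=> rP hr; have := rP h hr; have [/(_ (x + h)) + _] := fconv.
  by case: (f (x + h)).
have litt : fine \o f \o shift x = cst ((fine \o f) x) + dotv w +o_ (0 : 'rV[R]_d) id.
  apply/eqaddoP => eps e0.
  have [r1 r10 rP1] := frechet_upper e0.
  have [r2 r20 rP2] := frechet_lower e0.
  near=> h.
  have h1 : `|h| <= r1 by rewrite -(subr0 h); near: h; exact: near_norm_le.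
  have h2 : `|h| <= r2 by rewrite -(subr0 h); near: h; exact: near_norm_le.
  have := rP1 h h1; have := rP2 h h2.
  rewrite /= !fctE /= fx /= (addrC h).
  case: (f (x + h)) => [a||]//=; rewrite !lee_fin => a1 a2.
  rewrite ler_norml; apply/andP; split; lra.
have dE := diff_unique (@dotv_continuous w) litt.
have [r r0 rP] := frechet_upper ltr01.
split.
- near=> y.
  have yx : `|y - x| <= r by near: y; exact: near_norm_le.
  by have := fin _ _ rP yx; rewrite addrC subrK.
- apply/diff_locallyP; rewrite dE; split => //.
  exact: dotv_continuous.
- by move=> h; rewrite dE.
Unshelve. all: by end_near. Qed.

End frechet.

(** * Almost everywhere differentiability of convex functions *)

Section ae_differentiability.
Context (R : realType) (d : nat) (f : 'rV[R]_d -> \bar R).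
Hypothesis fconv : convex_ext f.
Hypothesis mf : measurable_fun setT f.
Implicit Types (x e w : 'rV[R]_d).

Lemma measurable_translate (c : 'rV[R]_d) :
  measurable_fun setT (fun x => f (x + c)).
Proof.
apply: (measurableT_comp mf); apply: continuous_measurable_rV => x.
apply: (@continuousD _ _ _ id (cst c)); first exact: cvg_id.
exact: cst_continuous.
Qed.

Definition kinks e := [set x | (f x < +oo)%E /\ ~ smooth_along f e x].

Lemma measurable_kinks e : measurable (kinks e).
Proof.
rewrite (_ : kinks e = [set x | (f x < +oo)%E] `\`
  \bigcap_k \bigcup_n [set x | (f (x + n.+1%:R^-1 *: e)%R + f (x - n.+1%:R^-1 *: e)%R <
    f x + f x + (k.+1%:R^-1 * n.+1%:R^-1)%:E)%E]); last first.
  apply/seteqP; split => x [fx sx]; split => //.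
    by apply: contra_not sx => sx k; have [n _ xn] := sx k I; exists n.
  by apply: contra_not sx => sx k _; have [n xn] := sx k; exists n.
apply: measurableD.
  by rewrite -[X in measurable X]setTI; exact: measurable_lte.
apply: bigcap_measurable => // k _; apply: bigcup_measurable => n _.
rewrite -[X in measurable X]setTI; apply: measurable_lte => //.
  by apply: emeasurable_funD; exact: measurable_translate.
by apply: emeasurable_funD => //; exact: emeasurable_funD.
Qed.

(** The kinks along an axis form a Borel set that meets every line parallel to this
    axis in a countable set. *)
Lemma ae_smooth_along (mu : {measure set 'rV[R]_d -> \bar R}) :
  mu `<< @lebesgue_rV R d ->
  {ae mu, forall x, (f x < +oo)%E ->
    forall i : 'I_d, smooth_along f (delta_mx 0 i) x}.
Proof.
move=> ac.
have neg (i : 'I_d) : mu.-negligible (kinks (delta_mx 0 i)).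
  exists (kinks (delta_mx 0 i)); split => //; first exact: measurable_kinks.
  apply: ac (measurable_kinks _) (@subset_refl _ _) => A mA Ak.
  apply: (lebesgue_rV_countable_lines (i := i)) => // x.
  apply: sub_countable (countable_kinks fconv (delta_mx 0 i) x).
  by apply: subset_card_le => t /= /Ak.
have : \forall x \ae mu, forall n : nat, forall i : 'I_d, val i = n ->
    (f x < +oo)%E -> smooth_along f (delta_mx 0 i) x.
  apply: ae_foralln => n; case: (ltnP n d) => [nd|dn].
    apply: (negligibleS _ (neg (Ordinal nd))) => x /= /existsNP[i] /not_implyP[iE].
    by move=> /not_implyP[fx sx]; rewrite /kinks /= -(_ : i = Ordinal nd)//;
      exact: val_inj.
  apply: aeW => x i iE; exfalso.
  by have := ltn_ord i; rewrite [nat_of_ord i]iE ltnNge dn.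
by apply: filterS => x xP fx i; exact: (xP _ i).
Qed.

(** Difference quotients of a convex function decrease with the step, so the
    infimum over the steps [1 / n.+1] is the partial derivative wherever it
    exists, while being a Borel function of [x] everywhere. *)
Definition partial_inf e x : \bar R :=
  einfs (fun n => (n.+1%:R)%:E * (f (x + n.+1%:R^-1 *: e)%R - f x))%E 0%N.

Lemma has_partial_inf e x v p : f x = v%:E -> has_partial f x e v p ->
  partial_inf e x = p%:E.
Proof.
move=> fx [plo pup]; rewrite /partial_inf fx.
have slope n (b : R) : (f (x + n.+1%:R^-1 *: e) <= (v + b * n.+1%:R^-1)%:E)%E ->
    ((n.+1%:R)%:E * (f (x + n.+1%:R^-1 *: e)%R - v%:E) <= b%:E)%E.
  move=> fb; have -> : b%:E = (n.+1%:R%:E * (b * n.+1%:R^-1)%:E)%E.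
    by rewrite -EFinM mulrCA divff ?mulr1// pnatr_eq0.
  by rewrite lee_wpmul2l ?lee_fin// leeBlDr// -EFinD (addrC (b * _)).
have slope2 n : (p%:E <= (n.+1%:R)%:E * (f (x + n.+1%:R^-1 *: e)%R - v%:E))%E.
  have -> : p%:E = (n.+1%:R%:E * (p * n.+1%:R^-1)%:E)%E.
    by rewrite -EFinM mulrCA divff ?mulr1// pnatr_eq0.
  rewrite lee_wpmul2l ?lee_fin// leeBrDr// -EFinD (addrC (p * _)).
  by apply: plo; rewrite invr_gt0.
apply/eqP; rewrite eq_le; apply/andP; split; last first.
  by apply: le_ereal_inf_tmp => _ [n _ <-]; exact: slope2.
apply/lee_addgt0Pr => eps e0; have [r r0 rP] := pup eps e0.
have [n nr] := exists_inv_lt r0.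
apply: ereal_inf_le; eexists; first by exists n.
apply: slope; rewrite mulrDl addrA.
have n0 : 0 < n.+1%:R^-1 :> R by rewrite invr_gt0.
have := rP n.+1%:R^-1; rewrite (gtr0_norm n0) => h.
by apply: (le_trans (h (ltW nr))).
Qed.

Definition gradient_map x : 'rV[R]_d :=
  \row_i fine (partial_inf (delta_mx 0 i) x).

Lemma measurable_gradient_map : measurable_fun setT gradient_map.
Proof.
apply: measurable_fun_rV => i; under eq_fun do rewrite mxE.
apply: measurableT_comp => //.
apply: measurable_fun_einfs => n; apply: measurable_funeM.
by apply: emeasurable_funB => //; exact: measurable_translate.
Qed.

Lemma smooth_has_gradient x v : f x = v%:E ->
  (forall i, smooth_along f (delta_mx 0 i) x) ->
  forall i, has_partial f x (delta_mx 0 i) v (gradient_map x 0 i).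
Proof.
move=> fx sx i; have [p px] := smooth_has_partial fconv fx (sx i).
by rewrite mxE (has_partial_inf fx px).
Qed.

End ae_differentiability.

(** * Probabilities compared on open sets *)

Section open_domination.
Context (R : realType) (d : nat).

(** A closed set is a decreasing intersection of open sets, hence the inequality also
    holds on closed sets; taking complements reverses it on open sets, which
    generate the Borel sets. *)
Lemma eq_measure_of_le_open (P Q : probability 'rV[R]_d R) :
  (forall U, open U -> (P U <= Q U)%E) ->
  forall A, measurable A -> P A = Q A.
Proof.
move=> PQ; apply: (measure_unique (@open 'rV[R]_d) (fun=> setT)) => //.
- by move=> A B; exact: openI.
- by move=> _; exact: openT.
- by apply/seteqP; split => // x _; exists 0%N.
- move=> U oU; apply/eqP; rewrite eq_le PQ//=.
  have mU := open_measurable_rV oU.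
  pose F := ~` U; have mF : measurable F by exact: measurableC.
  pose G n := \bigcup_(x in F) (ball x n.+1%:R^-1).
  have oG n : open (G n) by apply: bigcup_open => x _; exact: ball_open.
  have mG n : measurable (G n) by exact: open_measurable_rV.
  have FG : F = \bigcap_n G n.
    apply/seteqP; split => [x Fx n _|x Gx].
      by exists x => //; exact: ballxx.
    have cF : closed F by exact: open_closedC.
    apply: cF => B /nbhs_ballP[e /= e0 eB].
    have [n ne] := exists_inv_lt e0.
    have [y Fy yx] := Gx n I; exists y; split => //.
    by apply: eB; apply: (le_ball (ltW ne)); exact: ball_sym.
  have PF : (P F <= Q F)%E.
    have ni : nonincreasing_seq G.
      move=> m n mn; apply/subsetPset => x [y Fy yx]; exists y => //.
      by apply: le_ball yx; rewrite lef_pV2 ?posrE// ler_nat.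
    have cvgP (M : probability 'rV[R]_d R) : (M \o G) n @[n --> \oo] --> M F.
      rewrite FG; apply: nonincreasing_cvg_mu => //.
      - by rewrite (le_lt_trans (probability_le1 _ _))// ltry.
      - exact: bigcapT_measurable.
    rewrite -(cvg_lim _ (cvgP Q))//; apply: lime_ge.
      by apply/cvg_ex; exists (Q F).
    apply: nearW => n; apply: le_trans (PQ _ (oG n)).
    by rewrite le_measure ?inE// FG; exact: bigcap_inf.
  move: PF; rewrite /F !probability_setC// => PF.
  have fP : P U \is a fin_num by exact: fin_num_measure.
  have fQ : Q U \is a fin_num by exact: fin_num_measure.
  by move: PF; rewrite -(fineK fP) -(fineK fQ) -!EFinB !lee_fin; lra.
- by move=> _; rewrite (le_lt_trans (probability_le1 _ _))// ltry.
Qed.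

End open_domination.

(** * The pairing of x with sigma y *)

Section self_dual.
Context (R : realType) (d : nat) (sigma : {linear 'rV[R]_d -> 'rV[R]_d}).
Hypothesis sigma_selfadjoint : selfadjoint sigma.
Hypothesis sigma_invol : forall x, sigma (sigma x) = x.
Implicit Types (x y z w : 'rV[R]_d) (phi : 'rV[R]_d -> \bar R).

Definition twisted x y : R := dotv x (sigma y).
Definition half_sq x : R := dotv x x / 2.

Lemma twistedC x y : twisted x y = twisted y x.
Proof. by rewrite /twisted -sigma_selfadjoint dotvC. Qed.

Lemma dotvDr x y z : dotv x (y + z) = dotv x y + dotv x z.
Proof. exact: linearD. Qed.

Lemma dotvZr (a : R) x y : dotv x (a *: y) = a * dotv x y.
Proof. exact: linearZ. Qed.

Lemma twistedDl x y z : twisted (x + y) z = twisted x z + twisted y z.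
Proof. by rewrite /twisted dotvC dotvDr !(dotvC (sigma z)). Qed.

Lemma twistedZl (a : R) x y : twisted (a *: x) y = a * twisted x y.
Proof. by rewrite /twisted dotvC dotvZr (dotvC (sigma y)). Qed.

Lemma twisted_delta (i : 'I_d) y : twisted (delta_mx 0 i) y = sigma y 0 i.
Proof.
rewrite /twisted /dotv (bigD1 i)//= big1 ?addr0 => [|j ji].
  by rewrite mxE !eqxx mul1r.
by rewrite mxE (negbTE ji) andbF mul0r.
Qed.

(** Expand [dotv z z >= 0] for [z = x + sigma y] and [z = x - sigma y], where [sigma]
    is an isometry. *)
Lemma twisted_le x y : `|twisted x y| <= half_sq x + half_sq y.
Proof.
have sq z : 0 <= dotv z z by apply: sumr_ge0 => i _; rewrite -expr2 sqr_ge0.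
have sy : dotv (sigma y) (sigma y) = dotv y y.
  by rewrite sigma_selfadjoint sigma_invol.
have exp (a : R) : dotv (x + a *: sigma y) (x + a *: sigma y) =
    dotv x x + 2 * a * twisted x y + a ^+ 2 * dotv y y.
  rewrite dotvDr dotvZr !(dotvC (x + _)) !dotvDr !dotvZr sy (dotvC (sigma y) x).
  by rewrite /twisted; ring.
have h1 := sq (x + 1 *: sigma y); have h2 := sq (x + (-1) *: sigma y).
rewrite exp in h1; rewrite exp in h2.
by rewrite ler_norml /half_sq; apply/andP; split; lra.
Qed.

Lemma measurable_half_sq : measurable_fun setT half_sq.
Proof.
apply: measurable_funM => //; apply: measurable_sum => i.
by apply: measurable_funM; exact: measurable_coord_rV.
Qed.

Lemma half_sq_integrable (mu : probability 'rV[R]_d R) :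
  finite_second_moment mu -> (\int[mu]_x (half_sq x)%:E < +oo)%E.
Proof.
apply: le_lt_trans; apply: ge0_le_integral => //.
- by move=> x _; rewrite lee_fin divr_ge0// sumr_ge0// => i _; rewrite -expr2 sqr_ge0.
- by apply/measurable_EFinP; exact: measurable_half_sq.
- apply/measurable_EFinP; apply: measurable_sum => i.
  by apply: measurable_funM; exact: measurable_coord_rV.
- move=> x _; rewrite lee_fin /half_sq ler_pdivrMr// ler_peMr ?ler1n//.
  by apply: sumr_ge0 => i _; rewrite -expr2 sqr_ge0.
Qed.

Lemma legendre_twisted phi x : legendre phi (sigma x) = conjugate twisted phi x.
Proof.
congr ereal_sup; apply: eq_imagel => y _.
by rewrite /twisted -/(twisted x y) twistedC.
Qed.

(** Restricting the supremum to [Y] measures how close [c x y <= phi x + phi y] comes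
    to equality for [y] in [Y]. *)
Definition partial_conjugate (Y : set 'rV[R]_d) phi x : \bar R :=
  ereal_sup [set ((twisted x y)%:E - phi y)%E | y in Y].

(** A supremum of affine functions is lower semicontinuous. *)
Lemma measurable_partial_conjugate Y phi : (forall y, phi y != -oo)%E ->
  measurable_fun setT (partial_conjugate Y phi).
Proof.
move=> phiN; apply: lsc_measurable_rV => a.
rewrite (_ : [set x | _] =
    \bigcup_(y in Y) [set x | (a%:E < (twisted x y)%:E - phi y)%E]); last first.
  apply/seteqP; split => x /=.
    by move=> /ereal_sup_gt[_ [y Yy <-] ay]; exists y.
  by move=> [y Yy ay]; apply: (lt_le_trans ay); apply: ereal_sup_ubound; exists y.
apply: bigcup_open => y Yy; have := phiN y; case: (phi y) => [r||]// _.
  rewrite (_ : [set x | _] = (dotv (sigma y) : 'rV[R]_d -> R) @^-1` `]a + r, +oo[).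
    apply: open_comp; last exact: interval_open.
    by move=> x _; exact: dotv_continuous.
  apply/seteqP; split => x /=; rewrite in_itv /= andbT /twisted dotvC;
  by rewrite -EFinB lte_fin ltrBrDr.
Qed.

Context (phi : 'rV[R]_d -> \bar R).
Hypothesis phi_adm : admissible twisted phi.
Hypothesis phi_self : forall x, conjugate twisted phi x = phi x.

Lemma self_conjugate_convex : convex_ext phi.
Proof.
split=> [x|x y t /andP[t0 t1]]; first by rewrite -ltNye (admissible_gtNy x phi_adm).
rewrite -[leLHS]phi_self; apply: ge_ereal_sup => _ [z _ <-].
have := conjugate_ge twisted phi x z; have := conjugate_ge twisted phi y z.
have := admissible_gtNy z phi_adm; rewrite !phi_self.
case: (phi z) => [r||]// _ yz xz; last by rewrite /= addeNy leNye.
apply: (@le_trans _ _ (t%:E * ((twisted x z)%:E - r%:E) +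
    (1 - t)%:E * ((twisted y z)%:E - r%:E))%E); last first.
  by apply: leeD; rewrite lee_wpmul2l// lee_fin// subr_ge0.
rewrite -!EFinB -!EFinM -EFinD lee_fin twistedDl !twistedZl.
by rewrite le_eqVlt; apply/orP; left; apply/eqP; ring.
Qed.

Lemma self_conjugate_measurable : measurable_fun setT phi.
Proof.
rewrite (_ : phi = partial_conjugate setT phi); last first.
  by apply/funext => x; rewrite -[LHS]phi_self.
apply: measurable_partial_conjugate => y.
by rewrite -ltNye (admissible_gtNy y phi_adm).
Qed.

(** Suppose that [sigma y] differs from the gradient [w] by at least [rho] in the
    coordinate [i].  Apply the constraint at [x + a e_i] instead of [x], with the
    sign of [a] chosen for the linear terms to differ by at least [rho * |a|]; for
    small [a] the error of the first-order expansion costs only half of it. *)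
Lemma gradient_gap (V : set 'rV[R]_d) x v w :
  open V -> V w -> phi x = v%:E ->
  (forall i, has_partial phi x (delta_mx 0 i) v (w 0 i)) ->
  exists2 eps : R, 0 < eps &
    (partial_conjugate (~` (sigma @^-1` V)) phi x + eps%:E <= phi x)%E.
Proof.
move=> oV Vw phix pw.
have /nbhs_ballP[rho /= rho0 rhoV] : nbhs w V by exact: open_nbhs_nbhs.
have rho2 : 0 < rho / 2 by rewrite divr_gt0.
have ex_r (i : 'I_d) : exists r : R, 0 < r /\ forall s : R, `|s| <= r ->
    (phi (x + s *: delta_mx 0 i)%R <=
     (v + w 0%R i * s + rho / 2 * `|s|)%:E)%E.
  by have [_ /(_ _ rho2)[r r0 rP]] := pw i; exists r.
have [r rP] := choice ex_r.
have [s s0 sr] := common_lower_bound (fun i => (rP i).1).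
exists (rho / 2 * s); first by rewrite mulr_gt0.
rewrite -leeBrDr// phix -EFinB.
apply: ge_ereal_sup => _ [y /= yV <-].
have [i yi] : exists i, rho <= `|w 0 i - sigma y 0 i|.
  apply: contrapT => /forallNP noi; apply: yV; apply: rhoV.
  split => // k i; rewrite (ord1 k) /ball /= ltNge; apply/negP; exact: noi.
have [a [as_ ale]] : exists a : R, `|a| = s /\
    (w 0 i - sigma y 0 i) * a <= - (rho * s).
  have [h|h] := leP 0 (w 0 i - sigma y 0 i).
    exists (- s); split; first by rewrite normrN gtr0_norm.
    by rewrite mulrN lerN2 ler_pM2r// -(ger0_norm h).
  exists s; split; first by rewrite gtr0_norm.
  rewrite -mulNr ler_pM2r// lerNr.
  by rewrite -(ltr0_norm h).
have := (rP i).2 a; rewrite as_ => /(_ (sr i)) up.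
have := phi_adm (x + a *: delta_mx 0 i) y.
rewrite twistedDl twistedZl twisted_delta => ad.
have := le_trans ad (leeD up (lexx (phi y))).
have := admissible_gtNy y phi_adm; case: (phi y) => [b||]// _; last first.
  by rewrite /= addeNy leNye.
rewrite -EFinD -EFinB !lee_fin => h.
have rhos : rho / 2 * s = rho * s / 2 by field.
rewrite rhos in h *; rewrite mulrBl in ale; rewrite (mulrC a) in h.
move: (w 0 i * a) (sigma y 0 i * a) (rho * s) ale h => A B D ale h; lra.
Qed.

End self_dual.

(** * The self-dual Brenier map *)

Lemma linear_rV_continuous (R : realType) (d : nat)
    (s : {linear 'rV[R]_d -> 'rV[R]_d}) : continuous s.
Proof.
have -> : (s : 'rV[R]_d -> 'rV[R]_d) =
    fun x => \sum_i x 0 i *: s (delta_mx 0 i).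
  apply/funext => x; rewrite [in LHS](row_sum_delta x) linear_sum.
  by apply: eq_bigr => i _; rewrite linearZ.
have c i : xpredT i -> continuous (fun x : 'rV[R]_d => x 0 i *: s (delta_mx 0 i)).
  move=> _ x; have cx := @coord_continuous R 1 d 0 i x.
  by apply: (@cvgZr_tmp R 'rV[R]_d _ _ _ _ _ (s (delta_mx 0 i)) cx).
exact: (continuous_big (@add_continuous 'rV[R]_d) c).
Qed.

Lemma pushforward_eq_of_le_open (R : realType) (d : nat)
    (mu : probability 'rV[R]_d R) (S T : 'rV[R]_d -> 'rV[R]_d) :
  measurable_fun setT S -> measurable_fun setT T ->
  (forall V, open V -> mu (T @^-1` V) <= mu (S @^-1` V))%E ->
  forall A, measurable A -> pushforward mu T A = pushforward mu S A.
Proof.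
move=> mS mT le.
pose S' : {mfun 'rV[R]_d >-> 'rV[R]_d} :=
  HB.pack S (isMeasurableFun.Build _ _ _ _ S mS).
pose T' : {mfun 'rV[R]_d >-> 'rV[R]_d} :=
  HB.pack T (isMeasurableFun.Build _ _ _ _ T mT).
exact: (@eq_measure_of_le_open _ _ (distribution mu T') (distribution mu S') le).
Qed.

Theorem corollary2p2 (R : realType) (d : nat)
    (mu : probability 'rV[R]_d R)
    (mu_second_moment : finite_second_moment mu)
    (mu_ac : mu `<< @lebesgue_rV R d)
    (sigma : {linear 'rV[R]_d -> 'rV[R]_d})
    (sigma_selfadjoint : selfadjoint sigma)
    (sigma_invol : forall x, sigma (sigma x) = x) :
  exists phi : 'rV[R]_d -> \bar R,
    [/\ convex_ext phi,
        gradient_pushforward phi mu (pushforward mu sigma)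
      & forall x, legendre phi (sigma x) = phi x].
Proof.
set c := twisted sigma; pose q := @half_sq R d.
have csym : forall x y, c x y = c y x by exact: twistedC.
have cq : forall x y, `|c x y| <= q x + q y by exact: twisted_le.
have mq : measurable_fun setT q by exact: measurable_half_sq.
have qfin := half_sq_integrable mu_second_moment.
have [phi [phi_self phi_adm phi_min]] :=
  exists_self_conjugate_minimizer csym cq mq qfin.
have mphi := self_conjugate_measurable phi_adm phi_self.
have cphi := self_conjugate_convex phi_adm phi_self.
have {phi_min}[phi_fin phi_min] := phi_min mphi.
exists phi; split => //; last first.
  by move=> x; rewrite legendre_twisted.
have msigma : measurable_fun setT sigma.
  by apply: continuous_measurable_rV; exact: linear_rV_continuous.
pose T := gradient_map phi.
have mT : measurable_fun setT T by exact: measurable_gradient_map.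
have Kphi := admissible_potential mq phi_adm mphi.
have phiq_ge0 := potential_ge0 cq Kphi.
have ae_fin : {ae mu, forall x, (phi x < +oo)%E}.
  have : mu.-integrable setT (fun x => phi x + (q x)%:E)%E.
    apply/integrableP; split; first exact: Kphi.1.
    by under eq_integral do rewrite gee0_abs//.
  move=> /(integrable_ae measurableT); apply: filterS => x /(_ I).
  by case: (phi x) => // r _; rewrite ltry.
have ae_grad : {ae mu, forall x, exists2 v, phi x = v%:E &
    forall i, has_partial phi x (delta_mx 0 i) v (T x 0 i)}.
  apply: filterS2 (ae_smooth_along cphi mphi mu_ac) ae_fin => x sx fx.
  have [v phix] : exists v, phi x = v%:E.
    by have := admissible_gtNy x phi_adm; move: fx; case: (phi x) => // r; exists r.
  by exists v => //; apply: smooth_has_gradient => //; exact: sx.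
exists T; split => //.
  by apply: filterS ae_grad => x [v phix] /(has_partial_is_gradient cphi phix).
apply: pushforward_eq_of_le_open => // V oV.
have mV := open_measurable_rV oV.
pose U := sigma @^-1` V.
have mU : measurable U by rewrite -[U]setTI; exact: msigma.
pose M := partial_conjugate sigma (~` U) phi.
have mM : measurable_fun setT M.
  apply: measurable_partial_conjugate => y.
  by rewrite -ltNye (admissible_gtNy y phi_adm).
(* The points x for which the constraint has a margin 1 / n.+1 against every y
   outside U; these sets increase with n. *)
pose E (n : nat) := [set x | (M x + (n.+1%:R^-1)%:E <= phi x)%E].
have mE n : measurable (E n).
  rewrite -[E n]setTI; apply: measurable_lee => //.
  by apply: emeasurable_funD.
have leE n : (mu (E n) <= mu U)%E.
  have n0 : (0 : R) < n.+1%:R^-1 by rewrite invr_gt0.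
  apply: (slack_measure_le csym cq mq phi_adm mphi phi_fin phi_min mU (mE n) n0).
  move=> x y Ex Uy.
  have : ((c x y)%:E - phi y <= M x)%E by apply: ereal_sup_ubound; exists y.
  have := admissible_gtNy y phi_adm; have := admissible_gtNy x phi_adm.
  move: Ex; rewrite /E /=; move: (n.+1%:R^-1 : R) (c x y) => e cxy.
  case: (phi x) => [r||]//; case: (phi y) => [s||]//; rewrite ?leey//.
  case: (M x) => [m||]//; rewrite -EFinB -!EFinD !lee_fin; lra.
have ndE : nondecreasing_seq E.
  move=> m n mn; apply/subsetPset => x; apply: le_trans; rewrite leeD2l// lee_fin.
  by rewrite lef_pV2 ?posrE// ler_nat.
have mUE : measurable (\bigcup_n E n) by exact: bigcupT_measurable.
have leUE : (mu (\bigcup_n E n) <= mu U)%E.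
  have cvgE : (mu \o E) n @[n --> \oo] --> mu (\bigcup_n E n).
    exact: nondecreasing_cvg_mu.
  rewrite -(cvg_lim _ cvgE)//; apply: lime_le; first by apply/cvg_ex; eexists; exact: cvgE.
  exact: nearW.
have mTV : measurable (T @^-1` V) by rewrite -[X in measurable X]setTI; exact: mT.
apply: le_trans leUE.
have [N [mN N0 subN]] := ae_grad.
rewrite -(measureU0 mUE mN N0).
apply: le_measure; rewrite ?inE//.
  exact: measurableU.
move=> x TxV; have [Nx|Nx] := pselect (N x); first by right.
left; have [v phix pw] : exists2 v, phi x = v%:E &
    forall i, has_partial phi x (delta_mx 0 i) v (T x 0 i).
  by apply: contrapT => h; apply: Nx; exact: subN.
have [eps eps0 gap] := gradient_gap phi_adm oV TxV phix pw.
have [n ne] := exists_inv_lt eps0.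
exists n => //; apply: le_trans gap.
by rewrite leeD2l// lee_fin ltW.
Qed.
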